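(* Let $a>0$, $b>0$, $\frac32<p\le2$, $c>0$ and $q<p^*:=\frac{3p}{3-p}$, and assume that $$\text{either } q>p+\frac{2p^2}{3},\quad\text{or } q=p+\frac{2p^2}{3}\ \text{ and }\ c>\left(\frac{b|Q|_p^{\frac{2p^2}{3}}}{2}\right)^{\frac{3}{2p^2-3p}} .$$ Let $\overline t_q$ be the unique maximum point in $(0,+\infty)$ of $$f_q(t)=\frac ap t+\frac{b}{2p}t^2-\frac{c^{q-\frac{3(q-p)}{p}}}{p|Q|_p^{q-p}}\,t^{\frac{3(q-p)}{p^2}} .$$ Then the mountain pass level $\gamma(c)$ of $I$ on $S(c)$ satisfies $\gamma(c)=f_q(\overline t_q)$, and it is attained by $$\overline u_c=\frac{c\,\overline\mu_q^{\frac3p}}{|Q|_p}Q(\overline\mu_q x),\qquad \overline\mu_q=\frac{\overline t_q^{\frac1p}}{c},$$ i.e. $\overline u_c\in S(c)$ and $I(\overline u_c)=\gamma(c)$. Moreover, for some $\lambda\in\mathbb{R}$, $u=\overline u_c$ is a solution of $$-\left(a+b\int_{\mathbb{R}^3}|\nabla u|^p\,dx\right)\Delta_p u=\lambda|u|^{p-2}u+|u|^{q-2}u\quad\text{in }\mathbb{R}^3,\qquad |u|_p=c .$$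
   Context: $|\cdot|_s$ denotes the norm of $L^s(\mathbb{R}^3)$, $\Delta_p u=\mathrm{div}(|\nabla u|^{p-2}\nabla u)$, $S(c)=\{u\in W^{1,p}(\mathbb{R}^3):|u|_p=c\}$ and $$I(u)=\frac ap|\nabla u|_p^p+\frac{b}{2p}|\nabla u|_p^{2p}-\frac1q|u|_q^q .$$ Mountain pass geometry: $I$ has mountain pass geometry on $S(c)$ if there exists $K(c)>0$ such that, with $A_{K(c)}=\{u\in S(c):|\nabla u|_p^p\le K(c)\}$ and $\Gamma(c)=\{h\in C([0,1];S(c)):h(0)\in A_{K(c)},\ I(h(1))<0\}$, $$\gamma(c):=\inf_{h\in\Gamma(c)}\max_{t\in[0,1]}I(h(t))>\max\{I(h(0)),I(h(1))\}\quad\text{for all }h\in\Gamma(c).$$ The level $\gamma(c)$ in the claim is the one defined by these formulas with a constant $K(c)>0$ for which this strict inequality holds. $Q\in W^{1,p}(\mathbb{R}^3)$ (depending on $q$) is a ground-state solution (nontrivial solution of least action, unique up to translations and sign for $1<p\le2$) of $$-\frac{3(q-p)}{p^2}\Delta_p u+\left(1+\frac{(p-3)(q-p)}{p^2}\right)|u|^{p-2}u=|u|^{q-2}u\quad\text{in }\mathbb{R}^3 .$$ It is known that $|\nabla Q|_p^p=|Q|_p^p=\frac pq|Q|_q^q$ and that $|u|_q\le\left(\frac qp\frac{1}{|Q|_p^{q-p}}\right)^{1/q}|\nabla u|_p^{\frac{3(q-p)}{qp}}|u|_p^{1-\frac{3(q-p)}{qp}}$ for all $u\in W^{1,p}(\mathbb{R}^3)$.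 *)

(* Defs.v *)
From HB Require Import structures.
From mathcomp Require Import all_boot all_order all_algebra.
From mathcomp Require Import all_classical all_reals all_analysis measurable_realfun.

Set Implicit Arguments.
Unset Strict Implicit.
Unset Printing Implicit Defensive.
Import Order.TTheory GRing.Theory Num.Theory.
Import numFieldNormedType.Exports.

Local Open Scope classical_set_scope.
Local Open Scope ring_scope.

(* [measurableTypeR R] is convertible to [R]; with it the product carries the
   (Borel) sigma-algebra of [lebesgue_measure \x lebesgue_measure \x lebesgue_measure]
   as well as the usual (product) normed module structure. *)
Definition R3 (R : realType) : Type :=
  (measurableTypeR R * measurableTypeR R * measurableTypeR R)%type.

Section Definitions.
Context {R : realType}.
Implicit Types (u v g phi : R3 R -> R) (a b c p q s t K : R).

Definition leb3 : {measure set (R3 R) -> \bar R} :=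
  ((@lebesgue_measure R \x @lebesgue_measure R) \x @lebesgue_measure R)%E.

Definition basis3 (i : 'I_3) : R3 R :=
  ((i == 0 :> nat)%:R, (i == 1 :> nat)%:R, (i == 2 :> nat)%:R).

Definition partial (i : 'I_3) phi : R3 R -> R := fun x => 'D_(basis3 i) phi x.

Fixpoint Ck (k : nat) phi : Prop :=
  if k is k'.+1 then
    continuous phi /\
    forall i, (forall x, derivable phi x (basis3 i)) /\ Ck k' (partial i phi)
  else continuous phi.

(* the space C_c^oo(R^3) *)
Definition test_function phi : Prop :=
  (forall k, Ck k phi) /\ compact (closure [set x | phi x != 0]).

Definition locally_integrable3 u : Prop :=
  measurable_fun setT u /\
  forall A : set (R3 R), compact A -> leb3.-integrable A (EFin \o u).

Definition is_weak_partial (i : 'I_3) u g : Prop :=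
  [/\ locally_integrable3 u, locally_integrable3 g &
      forall phi, test_function phi ->
        \int[leb3]_x (u x * partial i phi x) = - \int[leb3]_x (g x * phi x)].

(* A representative of the weak derivative, which is unique almost everywhere;
   it is 0 by convention if there is no weak derivative. *)
Definition weak_partial (i : 'I_3) u : R3 R -> R :=
  xget (cst 0) [set g | is_weak_partial i u g].

(* W^{1,p}(R^3), through representatives; [p] is at least 1 wherever it is
   used. *)
Definition W1p p : set (R3 R -> R) :=
  [set u | u \in Lfun leb3 p%:E /\
     forall i, exists2 g, is_weak_partial i u g & g \in Lfun leb3 p%:E].

(* the Euclidean length of the weak gradient *)
Definition grad_abs u : R3 R -> R :=
  fun x => Num.sqrt (\sum_(i < 3) weak_partial i u x ^+ 2).

(* |u|_s *)
Definition norm_L s u : R := fine 'N[leb3]_s%:E[EFin \o u]%E.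

Definition W1p_dist p u v : R :=
  norm_L p (u \- v) + norm_L p (grad_abs (u \- v)).

Definition energy a b p q u : R :=
  a / p * norm_L p (grad_abs u) `^ p
  + b / (2 * p) * norm_L p (grad_abs u) `^ (2 * p)
  - q^-1 * norm_L q u `^ q.

Definition mass_sphere p c : set (R3 R -> R) :=
  [set u | W1p p u /\ norm_L p u = c].

(* C([0,1]; S(c)), S(c) having the metric of W^{1,p}(R^3); only the
   restriction of [h] to [0,1] matters. *)
Definition sphere_path p c : set (R -> R3 R -> R) :=
  [set h | (forall t, t \in `[0, 1] -> mass_sphere p c (h t)) /\
     forall t, t \in `[0, 1] ->
       W1p_dist p (h s) (h t) @[s --> within `[0, 1] (nbhs t)] --> 0].

Definition mp_start p c K : set (R3 R -> R) :=
  [set u | mass_sphere p c u /\ norm_L p (grad_abs u) `^ p <= K].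

Definition mp_paths a b p q c K : set (R -> R3 R -> R) :=
  [set h | [/\ sphere_path p c h, mp_start p c K (h 0) &
               energy a b p q (h 1) < 0]].

(* The supremum over [0,1] is a maximum, since the energy is continuous on
   W^{1,p}(R^3) for p <= q <= p^*. *)
Definition mp_level a b p q c K : \bar R :=
  ereal_inf [set ereal_sup [set (energy a b p q (h t))%:E | t in `[0, 1]]
            | h in mp_paths a b p q c K].

Definition mp_geometry a b p q c K : Prop :=
  0 < K /\
  forall h, mp_paths a b p q c K h ->
    ((Num.max (energy a b p q (h 0)) (energy a b p q (h 1)))%:E
       < mp_level a b p q c K)%E.

(* The pairing of - div (|grad u|^{p-2} grad u) with a test function. When
   p < 2 the integrand is 0 where grad u = 0. *)
Definition plaplace_form p u phi : R :=
  \int[leb3]_x (grad_abs u x `^ (p - 2)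
                * \sum_(i < 3) weak_partial i u x * partial i phi x).

(* the pairing of |u|^{s-2} u with a test function *)
Definition power_form s u phi : R :=
  \int[leb3]_x (`|u x| `^ (s - 2) * u x * phi x).

(* (weak) solutions in W^{1,p}(R^3) of
   - 3(q-p)/p^2 Delta_p u + (1 + (p-3)(q-p)/p^2) |u|^{p-2} u = |u|^{q-2} u *)
Definition limit_solution p q u : Prop :=
  W1p p u /\
  forall phi, test_function phi ->
    3 * (q - p) / p ^+ 2 * plaplace_form p u phi
    + (1 + (p - 3) * (q - p) / p ^+ 2) * power_form p u phi
    = power_form q u phi.

Definition nontrivial u : Prop := ~ {ae leb3, forall x, u x = 0}.

(* the functional whose Euler-Lagrange equation is the one above *)
Definition limit_action p q u : R :=
  3 * (q - p) / p ^+ 2 * (norm_L p (grad_abs u) `^ p / p)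
  + (1 + (p - 3) * (q - p) / p ^+ 2) * (norm_L p u `^ p / p)
  - norm_L q u `^ q / q.

Definition ground_state p q u : Prop :=
  [/\ limit_solution p q u, nontrivial u &
      forall v, limit_solution p q v -> nontrivial v ->
        limit_action p q u <= limit_action p q v].

(* (weak) solutions in W^{1,p}(R^3) of
   - (a + b int |grad u|^p) Delta_p u = lam |u|^{p-2} u + |u|^{q-2} u,
   |u|_p = c *)
Definition kirchhoff_solution a b p q c (lam : R) u : Prop :=
  [/\ W1p p u, norm_L p u = c &
      forall phi, test_function phi ->
        (a + b * \int[leb3]_x (grad_abs u x `^ p)) * plaplace_form p u phi
        = lam * power_form p u phi + power_form q u phi].

(* the function f_q, with m standing for |Q|_p *)
Definition fiber_map a b p q c (m : R) t : R :=
  a / p * t + b / (2 * p) * t ^+ 2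
  - c `^ (q - 3 * (q - p) / p) / (p * m `^ (q - p))
    * t `^ (3 * (q - p) / p ^+ 2).

Definition unique_max_point (f : R -> R) t : Prop :=
  0 < t /\ forall s, 0 < s -> s != t -> f s < f t.

Definition scaled_profile p c (m mu : R) u : R3 R -> R :=
  fun x => c * mu `^ (3 / p) / m * u (mu *: x).

End Definitions.

(* Main.v *)
Require Import Defs.
From HB Require Import structures.
From mathcomp Require Import all_boot all_order all_algebra.
From mathcomp Require Import all_classical all_reals all_analysis measurable_realfun.
From mathcomp Require Import ring lra.
Import Order.TTheory GRing.Theory Num.Theory.
Import numFieldNormedType.Exports.

Set Implicit Arguments.
Unset Strict Implicit.
Unset Printing Implicit Defensive.

Local Open Scope classical_set_scope.
Local Open Scope ring_scope.

(* Write f for the fiber map and t0 for its maximum point.  The Gagliardo-Nirenberg inequality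
   gives I(u) >= f(|grad u|_p^p) on S(c), with equality when u is the dilation of Q, normalised
   in S(c), whose kinetic energy |grad u|_p^p is prescribed.  The kinetic energy is continuous in
   W^{1,p}, so a path from A_K to {I < 0} with K <= t0 crosses {|grad u|_p^p = t0} and its maximal
   energy is at least f(t0); the path formed by dilations of Q has maximal energy f(t0) (it is
   continuous because dilations act continuously on L^p).  The mountain pass inequality excludes
   K >= t0, since such a path may then start at its own maximum.  Finally, rescaling the
   equation of Q turns it into the Kirchhoff equation, whose two nonlocal coefficients match
   because f'(t0) = 0.
   Gradients are weak: their uniqueness is the du Bois-Reymond lemma, proved by letting test
   functions increase to indicators of boxes and extending to Borel sets by a pi-lambda
   argument. *)

(** The multiplier is read off an explicit rescaling, so neither differentiability of the energy nor
    a Palais-Smale sequence enters. Put th = 3(q-p)/p^2. The two alternatives on [q] say that th >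
    2, or that th = 2 and the coefficient of t^th exceeds b/(2p); this forces a critical point and
    makes f negative far out. At a critical point t0, f'(t0) = 0 eliminates that coefficient, and
    f(t0 r) becomes a positive combination of r - r^th/th and r^2 - (r^2)^(th/2)/(th/2). Both are
    largest at r = 1 by Bernoulli's inequality, which replaces any study of the sign of f'. Two
    features of the definitions shape the analysis. [weak_partial] chooses a representative for each
    function separately, so gradient identities hold only almost everywhere and norms are compared
    through explicit representatives. Real integrals are [fine] of extended ones; multiplication by
    a positive factor commutes with [fine] even at infinite values, so the weak equations are
    rescaled without proving their integrands integrable. *)

(** * Borel sets of R^3 and change of variables under dilations *)

Section R3_measure.
Context {R : realType}.
Local Notation leb := (@lebesgue_measure R).

Lemma leb3X (A B C : set (measurableTypeR R)) :
  measurable A -> measurable B -> measurable C ->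
  leb3 ((A `*` B) `*` C) = (leb A * leb B * leb C)%E.
Proof.
move=> mA mB mC.
transitivity (((leb \x leb) (A `*` B)) * leb C)%E.
  by apply: product_measure1E => //; exact: measurableX.
by congr (_ * _)%E; exact: product_measure1E.
Qed.

Definition obox (a b : R3 R) : set (R3 R) :=
  (`]a.1.1, b.1.1[ `*` `]a.1.2, b.1.2[) `*` `]a.2, b.2[.

Lemma measurable_obox a b : measurable (obox a b).
Proof. by apply: measurableX; [apply: measurableX|]; exact: measurable_itv. Qed.

Lemma leb3_obox a b : (leb3 (obox a b) < +oo)%E.
Proof.
rewrite (leb3X (A := `]a.1.1, b.1.1[%classic) (B := `]a.1.2, b.1.2[%classic)
 (C:=`]a.2, b.2[%classic))//; try exact: measurable_itv.
rewrite !lebesgue_measure_itv/=.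
by repeat case: ifPn => _; rewrite -?EFinM ?mule0 ?mul0e ?ltry.
Qed.

(** The corners are arbitrary: a badly ordered pair gives the empty box, and this makes the family
    closed under intersection. *)
Definition oboxes : set (set (R3 R)) := [set obox a b | a in setT & b in setT].

Lemma obox_setI_closed : setI_closed oboxes.
Proof.
move=> _ _ [a _ [b _ <-]] [a' _ [b' _ <-]].
exists ((Num.max a.1.1 a'.1.1, Num.max a.1.2 a'.1.2), Num.max a.2 a'.2) => //.
exists ((Num.min b.1.1 b'.1.1, Num.min b.1.2 b'.1.2), Num.min b.2 b'.2) => //.
rewrite /obox/=; apply/seteqP; split => -[[x y] z]/=; rewrite !in_itv/= !gt_max !lt_min.
  by move=> [[/andP[/andP[-> ->] /andP[-> ->]] /andP[/andP[-> ->] /andP[-> ->]]] /andP[/andP[-> ->] /andP[-> ->]]].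
by move=> [[[/andP[-> ->] /andP[-> ->]] /andP[-> ->]] [[/andP[-> ->] /andP[-> ->]] /andP[-> ->]]].
Qed.

Definition cube (n : nat) : set (R3 R) :=
  obox ((- n%:R, - n%:R), - n%:R) ((n%:R, n%:R), n%:R).

Lemma in_cube (x : R3 R) : \forall n \near \oo, cube n x.
Proof.
near=> n; rewrite /cube/obox/=; rewrite !in_itv/= -!ltr_norml.
split; first split; near: n; exact: nbhs_infty_gtr.
Unshelve. all: by end_near. Qed.

Lemma bigcup_cube : \bigcup_n cube n = setT.
Proof.
apply/seteqP; split => // x _; have [n _ h] := in_cube x.
by exists n => //; apply: h => /=.
Qed.

Let T : Type := (measurableTypeR R * measurableTypeR R * measurableTypeR R)%type.

(** The hard inclusion amounts to measurability of the identity from the sigma-algebra generated by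
    boxes to the product one. It is tested on half-spaces in each coordinate, and the trace of a
    half-space on a cube is a box. *)
Lemma measurable_R3E : @measurable _ (R3 R) = <<s oboxes >>.
Proof.
rewrite eqEsubset; split; last first.
  apply: smallest_sub; first exact: sigma_algebra_measurable.
  by move=> _ [a _ [b _ <-]]; exact: measurable_obox.
pose S := g_sigma_algebraType (oboxes : set (set T)).
suff : measurable_fun setT (idfun : S -> T).
  by move=> + A mA => /(_ measurableT A mA); rewrite setTI.
have cubeN n (x : T) : cube n x -> [/\ `|x.1.1| < n%:R, `|x.1.2| < n%:R & `|x.2| < n%:R].
  by rewrite /cube/obox/= !in_itv/= -!ltr_norml => -[[]].
have halfspace (f : T -> R) : (forall (y : R) n, oboxes ([set x | y < f x] `&` cube n)) ->
    measurable_fun setT (f : S -> measurableTypeR R).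
  move=> fO; apply: (measurability _ (RGenOInfty.measurableE R)).
  move=> _ [_ [y ->] <-]; rewrite setTI.
  rewrite (_ : _ @^-1` _ = \bigcup_n ([set x | y < f x] `&` cube n)).
    by apply: bigcupT_measurable => n; exact: sub_sigma_algebra.
  rewrite -setI_bigcupr bigcup_cube setIT.
  by apply/seteqP; split => x/=; rewrite in_itv/= andbT.
apply/measurable_fun_pairP; split; first (apply/measurable_fun_pairP; split).
- apply: (halfspace (fun x => x.1.1)) => y n.
  exists ((Num.max y (- n%:R), - n%:R), - n%:R) => //; exists ((n%:R, n%:R), n%:R) => //.
  apply/seteqP; split => x; rewrite /cube/obox/= !in_itv/= gt_max.
    by move=> [[/andP[/andP[-> ->] ->] ->] ->].
  by move=> [-> [[/andP[-> ->] ->] ->]].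
- apply: (halfspace (fun x => x.1.2)) => y n.
  exists ((- n%:R, Num.max y (- n%:R)), - n%:R) => //; exists ((n%:R, n%:R), n%:R) => //.
  apply/seteqP; split => x; rewrite /cube/obox/= !in_itv/= gt_max.
    by move=> [[-> /andP[/andP[-> ->] ->]] ->].
  by move=> [-> [[-> /andP[-> ->]] ->]].
- apply: (halfspace (fun x => x.2)) => y n.
  exists ((- n%:R, - n%:R), Num.max y (- n%:R)) => //; exists ((n%:R, n%:R), n%:R) => //.
  apply/seteqP; split => x; rewrite /cube/obox/= !in_itv/= gt_max.
    by move=> [[-> ->] /andP[/andP[-> ->] ->]].
  by move=> [-> [[-> ->] /andP[-> ->]]].
Qed.

(** Induction principle for Borel sets, used once for vanishing integrals and once for the dilation
    continuity of indicators. *)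
Lemma lambda_system_R3 (H : set (set (R3 R))) : lambda_system setT H ->
  oboxes `<=` H -> forall A, measurable A -> H A.
Proof.
move=> Hl HO A; rewrite measurable_R3E => mA.
exact: (lambda_system_subset obox_setI_closed Hl HO).
Qed.

Lemma open_measurable_R3 (U : set (R3 R)) : open U -> measurable U.
Proof.
move=> oU.
pose I := (rat * rat * rat * (rat * rat * rat))%type.
pose pt (q : rat * rat * rat) : R3 R := ((ratr q.1.1, ratr q.1.2), ratr q.2).
(* The first set does not depend on its point: it is everything or empty according to whether the
   box lies in [U]. The union can thus range over all pairs of rational corners. *)
pose F (q : I) : set (R3 R) := [set x | obox (pt q.1) (pt q.2) `<=` U] `&` obox (pt q.1) (pt q.2).
have -> : U = \bigcup_q F q.
  apply/seteqP; split => [x Ux|x [q _ [h]]]; last exact: h.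
  have /nbhs_ballP[e /= e0 eU] : nbhs x U by exact: open_nbhs_nbhs.
  have rl (y : R) : exists q : rat, y - e < ratr q < y.
    have [q] := rat_in_itvoo (ltac:(lra) : y - e < y).
    by rewrite in_itv/=; exists q.
  have rr (y : R) : exists q : rat, y < ratr q < y + e.
    have [q] := rat_in_itvoo (ltac:(lra) : y < y + e).
    by rewrite in_itv/=; exists q.
  have [a1 /andP[h1 h1']] := rl x.1.1; have [a2 /andP[h2 h2']] := rl x.1.2.
  have [a3 /andP[h3 h3']] := rl x.2; have [b1 /andP[h4 h4']] := rr x.1.1.
  have [b2 /andP[h5 h5']] := rr x.1.2; have [b3 /andP[h6 h6']] := rr x.2.
  exists ((a1, a2, a3), (b1, b2, b3)) => //; split; last first.
    by rewrite /obox/pt/= !in_itv/= h1' h2' h3' h4 h5 h6.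
  move=> y; rewrite /obox/pt/= !in_itv/= => -[[/andP[i1 i2] /andP[i3 i4]] /andP[i5 i6]].
  apply: eU; split; first split; rewrite /ball/= ltr_norml; apply/andP; split; lra.
apply: countable_bigcupT_measurable; first exact: countableP.
move=> q; apply: measurableI; last exact: measurable_obox.
have [h|h] := pselect (obox (pt q.1) (pt q.2) `<=` U).
  by rewrite (_ : [set _ | _] = setT)//; apply/seteqP; split.
by rewrite (_ : [set _ | _] = set0)//; apply/seteqP; split => //.
Qed.

Lemma compact_measurable_R3 (K : set (R3 R)) : compact K -> measurable K.
Proof.
move=> cK; rewrite -[K]setCK; apply: measurableC; apply: open_measurable_R3.
apply: closed_openC; apply: compact_closed => //; exact: norm_hausdorff.
Qed.

Lemma continuous_measurable_R3 (f : R3 R -> R) : continuous f -> measurable_fun setT f.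
Proof.
move=> cf; apply: (measurability _ (RGenOInfty.measurableE R)).
move=> _ [_ [y ->] <-]; rewrite setTI; apply: open_measurable_R3.
by move/continuousP : cf; apply; exact: interval_open.
Qed.

Lemma continuous_scale_R3 (k : R) : continuous (fun x : R3 R => k *: x).
Proof. exact: scaler_continuous. Qed.

Lemma measurable_scale_R3 (k : R) : measurable_fun setT ((fun x => k *: x) : R3 R -> R3 R).
Proof.
apply/measurable_fun_pairP; split; first (apply/measurable_fun_pairP; split).
- apply: (measurable_funM (f := cst k) (g := fun x : R3 R => x.1.1)) => //.
  by apply: (@measurableT_comp _ _ _ _ _ _ fst _ fst).
- apply: (measurable_funM (f := cst k) (g := fun x : R3 R => x.1.2)) => //.
  by apply: (@measurableT_comp _ _ _ _ _ _ snd _ fst).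
- apply: (measurable_funM (f := cst k) (g := fun x : R3 R => x.2)) => //; exact: measurable_snd.
Qed.

Lemma leb3_oboxE a b : leb3 (obox a b) =
  ((Num.max 0 (b.1.1 - a.1.1)) * (Num.max 0 (b.1.2 - a.1.2)) *
    (Num.max 0 (b.2 - a.2)))%:E.
Proof.
rewrite (leb3X (A := `]a.1.1, b.1.1[%classic) (B := `]a.1.2, b.1.2[%classic)
 (C:=`]a.2, b.2[%classic))//; try exact: measurable_itv.
rewrite !lebesgue_measure_itv/= !lte_fin !EFinM.
have h (x y : R) : (if (x < y)%R then y%:E - x%:E else 0)%E = (Num.max 0 (y - x))%:E.
  case: ltP => xy; first by rewrite max_r// subr_ge0 ltW.
  by rewrite max_l// subr_le0.
by rewrite !h.
Qed.

(** The measure structure of a pushforward depends on a proof that the map is measurable, so the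
    canonical instance is applied to that proof by name. *)
Definition pushforward_scale (k : R) : {measure set (R3 R) -> \bar R} :=
  measure_function_pushforward__canonical__measure_function_Measure (@leb3 R) (measurable_scale_R3 k).

(** Two measures that agree and are finite on boxes coincide, since cubes exhaust the space; on
    boxes the claim is a product of three lengths. *)
Lemma leb3_scale (k : R) (k0 : 0 < k) A : measurable A ->
  leb3 A = mscale (NngNum (exprn_ge0 3 (ltW k0))) (pushforward_scale k) A.
Proof.
move=> mA; apply: (measure_unique oboxes cube) => //.
- exact: measurable_R3E.
- exact: obox_setI_closed.
- by move=> n; eexists => //; eexists.
- exact: bigcup_cube.
- move=> _ [a _ [b _ <-]].
  transitivity ((k ^+ 3)%:E * leb3 (obox (k^-1 *: a) (k^-1 *: b)))%E.
    rewrite !leb3_oboxE -EFinM; congr EFin.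
    rewrite /GRing.scale/= -!mulrBr.
    have h (x : R) : Num.max 0 (k^-1 * x) = k^-1 * Num.max 0 x.
      by rewrite maxr_pMr ?mulr0// invr_ge0 ltW.
    by rewrite !h; field; rewrite gt_eqF.
  congr (_ * leb3 _)%E.
  apply/seteqP; split => x; rewrite /obox/= !in_itv/= /GRing.scale/=.
    by rewrite !ltr_pdivrMl// !ltr_pdivlMl.
  by rewrite !ltr_pdivrMl// !ltr_pdivlMl.
- by move=> n; exact: leb3_obox.
Qed.

Lemma ge0_integral_scale (k : R) (f : R3 R -> \bar R) : 0 < k ->
  measurable_fun setT f -> (forall x, 0 <= f x)%E ->
  (\int[leb3]_x f (k *: x) = (k ^- 3)%:E * \int[leb3]_x f x)%E.
Proof.
move=> k0 mf f0.
have -> : (\int[leb3]_x f x = (k ^+ 3)%:E * \int[leb3]_x f (k *: x))%E.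
  transitivity (\int[mscale (NngNum (exprn_ge0 3 (ltW k0))) (pushforward_scale k)]_x f x)%E.
    by apply: eq_measure_integral => A mA _; exact: leb3_scale.
  etransitivity; first exact: (ge0_integral_mscale (pushforward_scale k) measurableT
    (NngNum (exprn_ge0 3 (ltW k0))) mf (fun x _ => f0 x)).
  exact: (congr1 (fun z => (NngNum (exprn_ge0 3 (ltW k0)))%:num%:E * z)%E
    (ge0_integral_pushforward (measurable_scale_R3 k) leb3 measurableT mf
      (fun x _ => f0 x))).
rewrite muleA -EFinM mulVf ?mul1e// expf_neq0// gt_eqF//.
Qed.

(** True even when both terms are infinite, since +oo - +oo is -oo by convention on each side. This
    spares the scaling of integrals every integrability hypothesis. *)
Lemma gt0_muleBr (k : R) (x y : \bar R) : 0 < k -> (0 <= x)%E -> (0 <= y)%E ->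
  (k%:E * (x - y) = k%:E * x - k%:E * y)%E.
Proof.
move=> k0; case: x => [r| |]//; case: y => [s| |]// _ _.
- by rewrite -EFinB -!EFinM -EFinB mulrBr.
- by rewrite /= ?gt0_muley ?lte_fin//= ?gt0_muleNy ?lte_fin.
- by rewrite /= ?gt0_muley ?lte_fin//= ?gt0_muleNy ?lte_fin.
- by rewrite /= ?gt0_muley ?lte_fin//= ?gt0_muleNy ?lte_fin.
Qed.

Lemma gt0_fineM (k : R) (x : \bar R) : 0 < k -> fine (k%:E * x)%E = k * fine x.
Proof.
move=> k0; case: x => [r//| |]/=.
  by rewrite gt0_muley ?lte_fin//= mulr0.
by rewrite gt0_muleNy ?lte_fin//= mulr0.
Qed.

Lemma integral_scale (k : R) (f : R3 R -> \bar R) : 0 < k ->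
  measurable_fun setT f ->
  (\int[leb3]_x f (k *: x) = (k ^- 3)%:E * \int[leb3]_x f x)%E.
Proof.
move=> k0 mf; rewrite integralE [in RHS]integralE.
rewrite gt0_muleBr ?invr_gt0 ?exprn_gt0//; [|exact: integral_ge0..].
have H1 := ge0_integral_scale k0 (measurable_funepos mf) (funepos_ge0 f).
have H2 := ge0_integral_scale k0 (measurable_funeneg mf) (funeneg_ge0 f).
rewrite -H1 -H2; congr (_ - _)%E; apply: eq_integral => x _; by rewrite ?funeposE ?funenegE.
Qed.

Lemma Rintegral_scale (k : R) (f : R3 R -> R) : 0 < k ->
  measurable_fun setT f ->
  \int[leb3]_x f (k *: x) = k ^- 3 * \int[leb3]_x f x.
Proof.
move=> k0 mf; rewrite /Rintegral (integral_scale (f := EFin \o f) k0)//.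
  by rewrite gt0_fineM// invr_gt0 exprn_gt0.
exact/measurable_EFinP.
Qed.

(** Positive and negative parts scale separately, and [fine] sends both infinities to 0, so the
    non-integrable cases agree as well. *)
Lemma gt0_RintegralZl d (X : measurableType d) (m : {measure set X -> \bar R})
    (k : R) (f : X -> R) : 0 < k -> measurable_fun setT f ->
  \int[m]_x (k * f x) = k * \int[m]_x f x.
Proof.
move=> k0 /measurable_EFinP mf; rewrite /Rintegral -gt0_fineM//; congr fine.
rewrite integralE [in RHS]integralE gt0_muleBr ?integral_ge0//.
have -> : (fun x => (k * f x)%:E) = (fun x => k%:E * (EFin \o f) x)%E by [].
rewrite ge0_funeposM ?ge0_funenegM ?lee_fin ?(ltW k0)//.
rewrite !ge0_integralZl ?lee_fin ?(ltW k0)//.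
- exact: measurable_funeneg.
- exact: measurable_funepos.
Qed.

End R3_measure.

(** * Smooth functions of one variable and the flat exponential *)

Section smooth_functions.
Context {R : realType}.
Implicit Types (f g h : R -> R) (P : {poly R}).

(** Order 0 demands nothing, not even continuity; under [smooth], continuity comes from order 1. *)
Fixpoint smooth_upto (n : nat) f : Prop :=
  if n is m.+1 then
    exists2 f' : R -> R, (forall x : R, is_derive x 1 f (f' x)) & smooth_upto m f'
  else True.

Definition smooth f := forall n, smooth_upto n f.

Lemma smooth_uptoW n f : smooth_upto n.+1 f -> smooth_upto n f.
Proof.
elim: n f => [//|n IH] f [f' df sf']; exists f' => //; exact: IH.
Qed.

Lemma smooth_uptoD n f g : smooth_upto n f -> smooth_upto n g ->
  smooth_upto n (fun x => f x + g x).
Proof.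
elim: n f g => [//|n IH] f g [f' df sf] [g' dg sg].
exists (fun x => f' x + g' x); last exact: IH.
by move=> x; have := df x; have := dg x => ? ?; exact: is_deriveD.
Qed.

Lemma smooth_uptoM n f g : smooth_upto n f -> smooth_upto n g ->
  smooth_upto n (fun x => f x * g x).
Proof.
elim: n f g => [//|n IH] f g /[dup] /smooth_uptoW sf0 [f' df sf].
move=> /[dup] /smooth_uptoW sg0 [g' dg sg].
exists (fun x => f x * g' x + g x * f' x); last by apply: smooth_uptoD; exact: IH.
by move=> x; have := df x; have := dg x => ? ?; exact: is_deriveM.
Qed.

Lemma smooth_upto_cst n (c : R) : smooth_upto n (cst c).
Proof.
elim: n c => [//|n IH] c; exists (cst 0) => //.
by move=> x; exact: is_derive_cst.
Qed.

Lemma smooth_upto_affine n f (k c : R) : smooth_upto n f ->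
  smooth_upto n (fun x => f (k * x + c)).
Proof.
elim: n f => [//|n IH] f [f' df sf].
exists (fun x => f' (k * x + c) * k); last first.
  by apply: smooth_uptoM; [exact: IH|exact: smooth_upto_cst].
move=> x; apply: (is_derive1_comp (df _)).
rewrite -[X in is_derive _ _ _ X]addr0.
apply: (@is_deriveD _ _ _ (fun y : R => k * y) (cst c)).
rewrite -[X in is_derive _ _ _ X]mulr1.
exact: (@is_deriveZ _ _ _ (id : R -> R) k).
Qed.

(* x |-> P(1/x) exp(-1/x), extended by 0; this family is closed under
   differentiation. *)
Definition flat_exp P (x : R) : R :=
  if 0 < x then P.[x^-1] * expR (- x^-1) else 0.

(** A single term of the exponential series gives y^n <= n! exp y for y >= 0; the constant collects
    these bounds over the coefficients. *)
Lemma horner_le_expR P : exists2 C : R, 0 <= C &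
  forall y, 0 <= y -> `|P.[y]| <= C * expR y.
Proof.
exists (\sum_(i < size P) `|P`_i| * i`!%:R).
  by apply: sumr_ge0 => i _; rewrite mulr_ge0.
move=> y y0; rewrite horner_coef (le_trans (ler_norm_sum _ _ _))// mulr_suml.
apply: ler_sum => i _; rewrite normrM -mulrA ler_wpM2l// ger0_norm ?exprn_ge0//.
case: (nat_of_ord i) => [|n].
  by rewrite expr0 fact0 mul1r (le_trans _ (expR_ge1Dx y))// lerDl.
rewrite mulrC -ler_pdivrMr ?ltr0n ?fact_gt0//.
by apply: le_trans (expR_ge1Dxn n y0); rewrite lerDr.
Qed.

(** Bounding y P(y) by C exp y instead of P(y) gains one power of y = 1/x, that is, a factor x. *)
Lemma flat_exp_le P : exists2 C : R, 0 <= C &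
  forall x, `|flat_exp P x| <= C * `|x|.
Proof.
have [C C0 h] := horner_le_expR (P * 'X).
exists C => // x; rewrite /flat_exp; case: ifPn => x0; last by rewrite normr0 mulr_ge0.
have xV0 : 0 <= x^-1 by rewrite invr_ge0 ltW.
have := h _ xV0; rewrite hornerM hornerX normrM (ger0_norm xV0) => h1.
rewrite normrM (ger0_norm (expR_ge0 _)) expRN (gtr0_norm x0).
by rewrite ler_pdivrMr ?expR_gt0// mulrAC -ler_pdivrMr.
Qed.

Lemma is_derive_flat_exp P (x : R) :
  is_derive x 1 (flat_exp P) (flat_exp ('X^2 * (P - P^`())) x).
Proof.
have [x0|x0|<-] := ltgtP 0 x.
- have dV : is_derive x (1 : R) (fun y : R => y^-1) (- x ^- 2).
    have := @is_deriveV _ id x 1 1 (lt0r_neq0 x0) (is_derive_id _ _).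
    by rewrite /GRing.scale/= mulr1.
  have dP := is_derive1_comp (is_derive_poly P x^-1) dV.
  have dN : is_derive x (1 : R) (fun y : R => - y^-1) (x ^- 2).
    by rewrite -[x ^- 2]opprK; exact: is_deriveN.
  have dE := @is_derive1_comp _ expR (fun y => - y^-1) x _ _ (is_derive_expR _) dN.
  apply: (near_eq_is_derive _ (is_derive_eq (is_deriveM dP dE) _)).
    near=> y; rewrite /flat_exp ifT//; near: y; exact: lt_nbhsr.
  rewrite /flat_exp x0 /GRing.scale/= !(hornerM, hornerXn, hornerD, hornerN).
  by rewrite !hornerX; field; rewrite gt_eqF.
- apply: (near_eq_is_derive _ (is_derive_eq (is_derive_cst (0 : R) x 1) _)).
    near=> y; rewrite /flat_exp ifF//; apply/negbTE; rewrite -leNgt ltW//; near: y.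
    exact: lt_nbhsl.
  by rewrite /flat_exp ifF// lt_gtF.
- rewrite {2}/flat_exp ltxx.
  suff H : (fun h : R => h^-1 *: ((flat_exp P \o shift 0) (h *: 1) - flat_exp P 0)) @ 0^' --> (0 : R).
    by apply: DeriveDef; [exact: cvgP H|exact: cvg_lim H].
  (* At 0 the difference quotient of [flat_exp P] is [flat_exp ('X * P)], which the linear bound
     sends to 0. *)
  have [C C0 hC] := flat_exp_le ('X * P).
  apply: (@squeeze_cvgr _ _ _ _ (fun h : R => - (C * `|h|)) (fun h : R => C * `|h|)).
  + near=> h; rewrite -ler_norml.
    rewrite /shift/= addr0 {2}/flat_exp ltxx subr0 /GRing.scale/= mulr1.
    rewrite (_ : h^-1 * _ = flat_exp ('X * P) h); first exact: hC.
    by rewrite /flat_exp; case: ifP; rewrite ?mulr0// hornerM hornerX mulrA.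
  + rewrite -[X in _ --> X]oppr0; apply: cvgN; rewrite -[X in _ --> X](mulr0 C).
    apply: cvgMl_tmp; rewrite -[X in _ --> X](normr0 R); apply: cvg_norm.
    exact: cvg_within.
  + rewrite -[X in _ --> X](mulr0 C).
    apply: cvgMl_tmp; rewrite -[X in _ --> X](normr0 R); apply: cvg_norm.
    exact: cvg_within.
Unshelve. all: by end_near. Qed.

Lemma smooth_flat_exp P : smooth (flat_exp P).
Proof.
move=> n; elim: n P => [//|n IH] P.
by exists (flat_exp ('X^2 * (P - P^`()))) => // x; exact: is_derive_flat_exp.
Qed.

End smooth_functions.

(** * Product test functions approximating indicators of boxes *)

Section test_functions.
Context {R : realType}.
Implicit Types (f g h : R -> R) (a b x : R3 R).

Definition tensor f g h : R3 R -> R := fun x => f x.1.1 * g x.1.2 * h x.2.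

(** A directional derivative sees only the line through [x], so a one-variable derivative transfers
    to it without any total differentiability. *)
Lemma is_derive_line f (phi : R3 R -> R) x (v : R3 R) (k r d : R) :
  is_derive r (1 : R) f d -> (forall s : R, phi (s *: v + x) = f (s + r) * k) ->
  is_derive x v phi (d * k).
Proof.
move=> df phiE.
have H : (fun s : R => s^-1 *: ((phi \o shift x) (s *: v) - phi x)) @ 0^' --> d * k.
  have phix : phi x = f r * k by rewrite -[x in phi x]add0r -(scale0r v) phiE add0r.
  have -> : (fun s : R => s^-1 *: ((phi \o shift x) (s *: v) - phi x)) =
     (fun s : R => (s^-1 *: ((f \o shift r) (s *: 1) - f r)) * k).
    apply/funext => s /=; rewrite phiE phix.
    by rewrite /GRing.scale/= mulr1 -mulrBl mulrA.
  apply: cvgMr_tmp; rewrite -(@derive_val _ _ _ _ _ _ _ df); exact: ex_derive.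
by apply: DeriveDef; [exact: cvgP H|exact: cvg_lim H].
Qed.

Lemma is_derive_tensor f f' g g' h h' x (i : 'I_3) :
  (forall r : R, is_derive r (1 : R) f (f' r)) ->
  (forall r : R, is_derive r (1 : R) g (g' r)) ->
  (forall r : R, is_derive r (1 : R) h (h' r)) ->
  is_derive x (basis3 i) (tensor f g h)
   (tensor (if i == 0 :> nat then f' else f) (if i == 1 :> nat then g' else g)
    (if i == 2 :> nat then h' else h) x).
Proof.
move=> df dg dh; rewrite /tensor; case: i => -[|[|[|//]]] i3 /=.
- rewrite -mulrA; apply: is_derive_line (df _) _ => s /=.
  by rewrite /GRing.scale/= mulr1 !mulr0 !add0r mulrA.
- rewrite (mulrC (f _)) -mulrA; apply: is_derive_line (dg _) _ => s /=.
  by rewrite /GRing.scale/= mulr1 !mulr0 !add0r; ring.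
- rewrite mulrC; apply: is_derive_line (dh _) _ => s /=.
  by rewrite /GRing.scale/= mulr1 !mulr0 !add0r; ring.
Qed.

Lemma continuous_tensor f g h : continuous f -> continuous g -> continuous h ->
  continuous (tensor f g h).
Proof.
move=> cf cg ch x; apply: cvgM; first apply: cvgM.
- apply: (@cvg_comp _ _ _ (fun y : R3 R => y.1.1) f); last exact: cf.
  by apply: (@cvg_comp _ _ _ (fun y : R3 R => y.1) fst); exact: cvg_fst.
- apply: (@cvg_comp _ _ _ (fun y : R3 R => y.1.2) g); last exact: cg.
  by apply: (@cvg_comp _ _ _ (fun y : R3 R => y.1) snd); [exact: cvg_fst|exact: cvg_snd].
- by apply: (@cvg_comp _ _ _ (fun y : R3 R => y.2) h); [exact: cvg_snd|exact: ch].
Qed.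

Lemma smooth_continuous f : smooth f -> continuous f.
Proof.
move=> /(_ 1%N) [f' df _] x; apply: differentiable_continuous.
by apply/derivable1_diffP; exact: ex_derive.
Qed.

(** Each order provides its own derivative; uniqueness of derivatives identifies them all with a
    single function. *)
Lemma smooth_derive f : smooth f -> exists2 f' : R -> R,
  (forall r : R, is_derive r (1 : R) f (f' r)) & smooth f'.
Proof.
move=> sf; have [f' df _] := sf 1%N; exists f' => // n.
have [f'' df' sf''] := sf n.+1.
suff -> : f' = f'' by [].
by apply/funext => r; rewrite -(@derive_val _ _ _ _ _ _ _ (df r)) (@derive_val _ _ _ _ _ _ _ (df' r)).
Qed.

Lemma Ck_tensor k f g h : smooth f -> smooth g -> smooth h -> Ck k (tensor f g h).
Proof.
elim: k f g h => [|k IH] f g h sf sg sh /=.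
  by apply: continuous_tensor; exact: smooth_continuous.
split; first by apply: continuous_tensor; exact: smooth_continuous.
have [f' df sf'] := smooth_derive sf; have [g' dg sg'] := smooth_derive sg.
have [h' dh sh'] := smooth_derive sh.
move=> i; split => [x|]; first by have := is_derive_tensor x i df dg dh => -[].
have -> : partial i (tensor f g h) =
   tensor (if i == 0 :> nat then f' else f) (if i == 1 :> nat then g' else g)
    (if i == 2 :> nat then h' else h).
  apply/funext => x; rewrite /partial.
  by rewrite (@derive_val _ _ _ _ _ _ _ (is_derive_tensor x i df dg dh)).
by apply: IH; case: ifP.
Qed.

Definition cbox a b : set (R3 R) :=
  (`[a.1.1, b.1.1] `*` `[a.1.2, b.1.2]) `*` `[a.2, b.2].

Lemma compact_cbox a b : compact (cbox a b).
Proof.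
by apply: compact_setX; [apply: compact_setX|]; exact: segment_compact.
Qed.

Lemma sub_obox_cbox a b : obox a b `<=` cbox a b.
Proof.
move=> x; rewrite /obox/cbox/= !in_itv/=.
by move=> [[/andP[/ltW-> /ltW->] /andP[/ltW-> /ltW->]] /andP[/ltW-> /ltW->]].
Qed.

Lemma compact_closure_sub (A K : set (R3 R)) : A `<=` K -> compact K -> compact (closure A).
Proof.
move=> AK cK; apply: (subclosed_compact _ cK); first exact: closed_closure.
have clK : closed K by apply: compact_closed => //; exact: norm_hausdorff.
by rewrite (closure_id K).1//; exact: closureS.
Qed.

(* exp(-1/((n+1)(r-s))) exp(-1/((n+1)(t-r))) on ]s, t[, which increases to the indicator of
   that interval; it yields test functions approximating indicators of boxes. *)
Definition itv_bump (s t : R) (n : nat) (r : R) : R :=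
  flat_exp 1 (n.+1%:R * (r - s)) * flat_exp 1 (n.+1%:R * (t - r)).

Lemma flat_exp1_itv (r : R) : 0 <= flat_exp 1 r <= 1.
Proof.
rewrite /flat_exp; case: ifPn => r0; rewrite ?lexx ?ler01//.
by rewrite hornerC mul1r expR_ge0 -expR0 ler_expR oppr_le0 invr_ge0 ltW.
Qed.

Lemma itv_bump_itv s t n r : 0 <= itv_bump s t n r <= 1.
Proof.
have /andP[h1 h2] := flat_exp1_itv (n.+1%:R * (r - s)).
have /andP[h3 h4] := flat_exp1_itv (n.+1%:R * (t - r)).
by rewrite /itv_bump mulr_ge0//= mulr_ile1.
Qed.

Lemma itv_bump_out s t n r : r \notin `]s, t[ -> itv_bump s t n r = 0.
Proof.
rewrite in_itv/= negb_and -!leNgt => /orP[rs|tr]; rewrite /itv_bump /flat_exp.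
  by rewrite ifF ?mul0r//; apply/negbTE; rewrite -leNgt pmulr_rle0// subr_le0.
by rewrite [X in _ * X]ifF ?mulr0//; apply/negbTE; rewrite -leNgt pmulr_rle0// subr_le0.
Qed.

Lemma cvg_flat_exp1 (r : R) : 0 < r -> flat_exp 1 (n.+1%:R * r) @[n --> \oo] --> (1 : R).
Proof.
move=> r0; have -> : (fun n => flat_exp 1 (n.+1%:R * r)) =
   (fun n => expR (- (r^-1 * n.+1%:R^-1))).
  by apply/funext => n; rewrite /flat_exp mulr_gt0// hornerC mul1r invfM mulrC.
rewrite -[X in _ --> X]expR0; apply: continuous_cvg; first exact: continuous_expR.
rewrite -[X in _ --> X]oppr0; apply: cvgN; rewrite -[X in _ --> X](mulr0 r^-1).
by apply: cvgMl_tmp; exact: (@cvg_harmonic R).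
Qed.

Lemma cvg_itv_bump s t r : r \in `]s, t[ -> itv_bump s t n r @[n --> \oo] --> (1 : R).
Proof.
rewrite in_itv/= => /andP[sr rt]; rewrite -[X in _ --> X]mulr1.
by apply: cvgM; apply: cvg_flat_exp1; rewrite subr_gt0.
Qed.

Lemma smooth_itv_bump s t n : smooth (itv_bump s t n).
Proof.
move=> k; apply: smooth_uptoM.
  have -> : (fun r => flat_exp 1 (n.+1%:R * (r - s))) =
    (fun r => flat_exp 1 (n.+1%:R * r + - (n.+1%:R * s))).
    by apply/funext => r; rewrite mulrBr.
  exact/smooth_upto_affine/smooth_flat_exp.
have -> : (fun r => flat_exp 1 (n.+1%:R * (t - r))) =
  (fun r => flat_exp 1 (- n.+1%:R * r + n.+1%:R * t)).
  by apply/funext => r; rewrite mulrBr mulNr addrC.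
exact/smooth_upto_affine/smooth_flat_exp.
Qed.

Definition box_bump a b n : R3 R -> R :=
  tensor (itv_bump a.1.1 b.1.1 n) (itv_bump a.1.2 b.1.2 n) (itv_bump a.2 b.2 n).

Lemma box_bump_itv a b n x : 0 <= box_bump a b n x <= 1.
Proof.
rewrite /box_bump /tensor.
have /andP[h1 h2] := itv_bump_itv a.1.1 b.1.1 n x.1.1.
have /andP[h3 h4] := itv_bump_itv a.1.2 b.1.2 n x.1.2.
have /andP[h5 h6] := itv_bump_itv a.2 b.2 n x.2.
apply/andP; split; first by apply: mulr_ge0 => //; exact: mulr_ge0.
by apply: mulr_ile1 => //; [exact: mulr_ge0|exact: mulr_ile1].
Qed.

Lemma box_bump_out a b n x : ~ obox a b x -> box_bump a b n x = 0.
Proof.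
rewrite /box_bump /tensor => nx.
have [h1|/itv_bump_out->] := boolP (x.1.1 \in `]a.1.1, b.1.1[); last by rewrite !mul0r.
have [h2|/itv_bump_out->] := boolP (x.1.2 \in `]a.1.2, b.1.2[); last by rewrite mulr0 mul0r.
have [h3|/itv_bump_out->] := boolP (x.2 \in `]a.2, b.2[); last by rewrite mulr0.
by exfalso; apply: nx.
Qed.

Lemma cvg_box_bump a b x : box_bump a b n x @[n --> \oo] --> (\1_(obox a b) x : R).
Proof.
rewrite indicE; have [|] := boolP (x \in obox a b).
  rewrite inE => -[[h1 h2] h3]; rewrite (_ : _%:R = 1 * 1 * 1); last by rewrite !mulr1.
  by apply: cvgM; [apply: cvgM|]; exact: cvg_itv_bump.
rewrite notin_setE => nx; rewrite (_ : (fun n => box_bump a b n x) = cst 0).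
  exact: cvg_cst.
by apply/funext => n; exact: box_bump_out.
Qed.

Lemma continuous_box_bump a b n : continuous (box_bump a b n).
Proof.
by apply: continuous_tensor; apply: smooth_continuous; exact: smooth_itv_bump.
Qed.

Lemma test_function_box_bump a b n : test_function (box_bump a b n).
Proof.
split=> [k|]; first by apply: Ck_tensor; exact: smooth_itv_bump.
apply: compact_closure_sub (@compact_cbox a b) => x /= x0.
apply: sub_obox_cbox; apply: contrapT => /(box_bump_out n) /eqP.
exact/negP.
Qed.

End test_functions.

(** * The du Bois-Reymond lemma *)

Section weak_derivatives.
Context {R : realType}.
Implicit Types (u v g h phi : R3 R -> R) (a b x : R3 R).

Lemma integrable_obox g a b : locally_integrable3 g ->
  leb3.-integrable (obox a b) (EFin \o g).
Proof.
move=> [mg gi]; apply: (@integrableS _ _ _ leb3 (cbox a b)).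
- by apply: compact_measurable_R3; exact: compact_cbox.
- exact: measurable_obox.
- exact: sub_obox_cbox.
- by apply: gi; exact: compact_cbox.
Qed.

Lemma integral_obox_eq0 g a b : locally_integrable3 g ->
  (forall phi, test_function phi -> \int[leb3]_x (g x * phi x) = 0) ->
  (\int[leb3]_(x in obox a b) (g x)%:E = 0)%E.
Proof.
move=> lg g0.
have mB := measurable_obox a b.
have gi := integrable_obox a b lg.
have mg : measurable_fun setT g by case: lg.
pose f n x := (g x * box_bump a b n x)%:E.
have mf n : measurable_fun setT (f n).
  apply/measurable_EFinP; apply: measurable_funM => //.
  by apply: continuous_measurable_R3; exact: continuous_box_bump.
have fle n x : (`|f n x| <= (`|g x|)%:E)%E.
  rewrite /f abse_EFin lee_fin normrM.
  have /andP[h1 h2] := box_bump_itv a b n x.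
  by rewrite (ger0_norm h1) ler_piMr.
have [] := @dominated_convergence _ _ _ leb3 (obox a b) mB f (EFin \o g)
  (fun x => `|(EFin \o g) x|%E).
- by move=> n; apply: measurable_funTS.
- by apply: measurable_funTS; exact/measurable_EFinP.
- apply: aeW => x Bx; apply: cvg_EFin; first exact: nearW.
  rewrite -[X in _ --> X]mulr1; apply: cvgMl_tmp.
  have := @cvg_box_bump _ a b x; rewrite indicE mem_set//.
- exact: integrable_abse.
- by apply: aeW => x n _; exact: fle.
move=> _ _ hlim.
apply/esym; apply: (cvg_unique _ _ hlim) => //.
have -> : [sequence (\int[leb3]_(x in obox a b) f n x)%E]_n = cst 0%E.
  apply/funext => n /=.
  have fB : f n \_ (obox a b) = f n.
    apply/funext => x; rewrite patchE; case: ifPn => //; rewrite notin_setE => nx.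
    by rewrite /f box_bump_out// mulr0.
  (* The hypothesis concerns [fine] of the integral, which is also 0 at infinite values;
     integrability is what turns it into an extended-real equality. *)
  have fi : leb3.-integrable setT (f n).
    rewrite -fB; apply/(integrable_mkcond _ mB).
    apply: (le_integrable mB _ _ gi) => //; exact: measurable_funTS.
  rewrite integral_mkcond fB -[LHS]fineK; last exact: integrable_fin_num.
  congr EFin; exact: (g0 _ (test_function_box_bump a b n)).
exact: cvg_cst.
Qed.

(** Since [g] is only locally integrable, the pi-lambda argument runs inside a cube: there |g| is a
    dominating function for increasing unions, and the trace of a box is again a box. *)
Lemma integral_cube_eq0 g (N : nat) A : locally_integrable3 g ->
  (forall phi, test_function phi -> \int[leb3]_x (g x * phi x) = 0) ->
  measurable A -> (\int[leb3]_(x in A `&` cube N) (g x)%:E = 0)%E.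
Proof.
move=> lg g0 mA.
have mg : measurable_fun setT (EFin \o g) by apply/measurable_EFinP; case: lg.
have mC : measurable (@cube R N) by exact: measurable_obox.
have gi := integrable_obox _ _ lg : leb3.-integrable (cube N) (EFin \o g).
pose H := [set A : set (R3 R) | measurable A /\
  (\int[leb3]_(x in A `&` cube N) (g x)%:E = 0)%E].
suff : H A by case.
apply: lambda_system_R3 mA; last first.
  move=> _ [a _ [b _ <-]]; split; first exact: measurable_obox.
  have [c _ [d _ <-]] : oboxes (obox a b `&` cube N).
    by apply: obox_setI_closed; eexists => //; eexists.
  exact: integral_obox_eq0.
split=> //.
- split=> //; rewrite setTI; exact: integral_obox_eq0.
- move=> B C CB [mB B0] [mC' C0]; split; first exact: measurableD.
  have <- : (\int[leb3]_(x in B `&` cube N) (g x)%:E = 0)%E by [].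
  rewrite -[in RHS](setDUK CB) setIUl integral_setU//.
  + by rewrite C0 add0e.
  + exact: measurableI.
  + by apply: measurableI => //; exact: measurableD.
  + exact: measurable_funTS.
  + by apply/eqP/seteqP; split => // x [[Cx _] [[_ nCx] _]].
- move=> F ndF HF; split; first by apply: bigcupT_measurable => n; case: (HF n).
  rewrite setIC integral_mkcondr.
  have [] := @dominated_convergence _ _ _ leb3 (cube N) mC
    (fun n => (EFin \o g) \_ (F n)) ((EFin \o g) \_ (\bigcup_n F n))
    (fun x => `|(EFin \o g) x|%E).
  + move=> n; apply: measurable_funTS.
    by apply/(measurable_restrict _ (proj1 (HF n)) measurableT); rewrite setTI; exact: measurable_funTS.
  + apply: measurable_funTS.
    have mU : measurable (\bigcup_n F n) by apply: bigcupT_measurable => n; case: (HF n).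
    by apply/(measurable_restrict _ mU measurableT); rewrite setTI; exact: measurable_funTS.
  + apply: aeW => x _; apply: cvg_near_cst.
    have [[m _ Fmx]|nF] := pselect ((\bigcup_n F n) x).
      apply: filterS (nbhs_infty_ge m) => n mn; rewrite !patchE !mem_set//; first by exists m.
      by move/subsetPset : (ndF m n mn); apply.
    by apply: nearW => n; rewrite !patchE !memNset// => Fnx; apply: nF; exists n.
  + exact: integrable_abse.
  + by apply: aeW => x n _; rewrite patchE; case: ifP => //; rewrite abse0.
  move=> _ _ hlim; apply/esym; apply: (cvg_unique _ _ hlim) => //.
  have -> : [sequence (\int[leb3]_(x in cube N) ((EFin \o g) \_ (F n)) x)%E]_n = cst 0%E.
    by apply/funext => n /=; rewrite -integral_mkcondr setIC; case: (HF n).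
  exact: cvg_cst.
Qed.

Lemma du_bois_reymond g : locally_integrable3 g ->
  (forall phi, test_function phi -> \int[leb3]_x (g x * phi x) = 0) ->
  {ae leb3, forall x, g x = 0}.
Proof.
move=> lg g0.
have : {ae leb3, forall x (n : nat), cube n x -> g x = 0}.
  apply: ae_foralln => n.
  have : ae_eq leb3 (cube n) (EFin \o g) (cst 0%E).
    apply: integral_ae_eq.
    - exact: measurable_obox.
    - exact: integrable_obox.
    - exact: measurable_cst.
    - move=> E EC mE; rewrite integral0.
      by rewrite -[E](setIidl EC); exact: integral_cube_eq0.
  by apply: filterS => x h Cx; apply: EFin_inj; exact: h.
by apply: filterS => x h; have [n _ /(_ n (leqnn n))] := in_cube x; exact: h.
Qed.

End weak_derivatives.

(** * Weak derivatives: differences, uniqueness, dilations *)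

Section weak_calculus.
Context {R : realType}.
Implicit Types (u v g h phi : R3 R -> R) (x : R3 R).

Definition compactly_supported phi :=
  exists2 K, compact K & forall x, ~ K x -> phi x = 0.

Lemma test_function_cs phi : test_function phi -> compactly_supported phi.
Proof.
move=> [_ cK]; eexists; first exact: cK.
move=> x nx; apply: contrapT => /eqP px; apply: nx.
exact: subset_closure.
Qed.

Lemma test_function_continuous phi : test_function phi -> continuous phi.
Proof. by move=> [/(_ 0%N)]. Qed.

Lemma partial_continuous phi i : test_function phi -> continuous (partial i phi).
Proof. by move=> [/(_ 1%N) [_ /(_ i) []]]. Qed.

Lemma partial_cs phi i : test_function phi -> compactly_supported (partial i phi).
Proof.
move=> [_ cK]; eexists; first exact: cK.
move=> x nx; rewrite /partial -(derive_cst (0 : R) x (basis3 i)).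
apply: near_eq_derive.
have : nbhs x (~` closure [set x | phi x != 0]).
  apply: open_nbhs_nbhs; split => //; apply: closed_openC; exact: closed_closure.
apply: filterS => y ny; apply: contrapT => /eqP py; apply: ny.
exact: subset_closure.
Qed.

Lemma integrableM_cs u phi : locally_integrable3 u -> continuous phi ->
  compactly_supported phi -> leb3.-integrable setT (fun x => (u x * phi x)%:E).
Proof.
move=> [mu ui] cphi [K cK phi0].
have mK := compact_measurable_R3 cK.
have mphi := continuous_measurable_R3 cphi.
have -> : (fun x => (u x * phi x)%:E) = ((EFin \o u) \* (EFin \o phi))%E \_ K.
  apply/funext => x; rewrite patchE; case: ifPn => //.
  by rewrite notin_setE => /phi0 ->; rewrite mulr0.
apply/(integrable_mkcond _ mK); apply: integrableMl => //.
- exact: ui.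
- exact: measurable_funTS.
have : compact (phi @` K).
  by apply: continuous_compact => //; exact: continuous_subspaceT.
move=> /compact_bounded [M [Mr hM]]; exists M; split => // N MN x Kx.
by apply: (hM N MN); exists x.
Qed.

Lemma locally_integrable3B u v : locally_integrable3 u -> locally_integrable3 v ->
  locally_integrable3 (u \- v).
Proof.
move=> [mu ui] [mv vi]; split; first exact: measurable_funB.
move=> A cA; have mA := compact_measurable_R3 cA.
exact: (integrableB mA (ui _ cA) (vi _ cA)).
Qed.

Lemma is_weak_partialB i u v g h : is_weak_partial i u g -> is_weak_partial i v h ->
  is_weak_partial i (u \- v) (g \- h).
Proof.
move=> [lu lg ug] [lv lh vh]; split; [exact: locally_integrable3B..|].
move=> phi tphi.
have cp := @partial_continuous _ i tphi; have sp := @partial_cs _ i tphi.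
have c := test_function_continuous tphi; have s := test_function_cs tphi.
transitivity (\int[leb3]_x (u x * partial i phi x - v x * partial i phi x)).
  by apply: eq_Rintegral => x _; rewrite mulrBl.
rewrite RintegralB//; [|exact: integrableM_cs..].
have -> : \int[leb3]_x ((g \- h) x * phi x) =
    \int[leb3]_x (g x * phi x) - \int[leb3]_x (h x * phi x).
  rewrite -RintegralB//; [|exact: integrableM_cs..].
  by apply: eq_Rintegral => x _; rewrite mulrBl.
by rewrite ug// vh//; ring.
Qed.

(** [g \- h] is a weak derivative of the zero function [u \- u], hence it is orthogonal to every
    test function. *)
Lemma is_weak_partial_unique i u g h : is_weak_partial i u g -> is_weak_partial i u h ->
  {ae leb3, forall x, g x = h x}.
Proof.
move=> ug uh; have [lu _ ug0] := ug; have [_ lh uh0] := uh.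
have [_ lgh gh0] := is_weak_partialB ug uh.
have : {ae leb3, forall x, (g \- h) x = 0}.
  apply: du_bois_reymond => // phi tphi.
  apply: oppr_inj; rewrite -gh0// oppr0 /Rintegral integral0_eq// => x _.
  by rewrite /= subrr mul0r.
by apply: filterS => x /eqP; rewrite subr_eq0 => /eqP.
Qed.

Lemma weak_partialP i u : (exists g, is_weak_partial i u g) ->
  is_weak_partial i u (weak_partial i u).
Proof. by case=> g ug; apply: xgetPex; exists g. Qed.

Lemma weak_partialE i u g : is_weak_partial i u g ->
  {ae leb3, forall x, weak_partial i u x = g x}.
Proof.
move=> ug; apply: is_weak_partial_unique (ug).
by apply: weak_partialP; exists g.
Qed.

(** No assumption on [u]: without a weak derivative, [xget] returns the zero function. *)
Lemma measurable_weak_partial i u : measurable_fun setT (weak_partial i u).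
Proof.
have [ex|nex] := pselect (exists g, is_weak_partial i u g).
  by have [_ []] := weak_partialP ex.
have -> : weak_partial i u = cst 0.
  by apply: xgetPN => g ug; apply: nex; exists g.
exact: measurable_cst.
Qed.

Lemma measurable_grad_abs u : measurable_fun setT (grad_abs u).
Proof.
apply: (@measurableT_comp _ _ _ _ _ _ (Num.sqrt : R -> R) _
  (fun x => \sum_(i < 3) weak_partial i u x ^+ 2)).
  by apply: continuous_measurable_fun; exact: sqrt_continuous.
apply: measurable_sum => i; apply: measurable_funX; exact: measurable_weak_partial.
Qed.

(** Derivability in one direction provides no differential to compose with, so the chain rule is a
    substitution in the difference quotient. *)
Lemma is_derive_scale (k : R) phi x (v : R3 R) : 0 < k ->
  derivable phi (k *: x) v ->
  is_derive x v (fun y => phi (k *: y)) (k * 'D_v phi (k *: x)).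
Proof.
move=> k0 dphi.
have H : (fun s : R => s^-1 *: (((fun y => phi (k *: y)) \o shift x) (s *: v) - phi (k *: x))) @ 0^' -->
    (k * 'D_v phi (k *: x)).
  have -> : (fun s : R => s^-1 *: (((fun y => phi (k *: y)) \o shift x) (s *: v) - phi (k *: x))) =
     (fun s : R => k * (((fun h : R => h^-1 *: ((phi \o shift (k *: x)) (h *: v) - phi (k *: x))) \o (fun s => k * s)) s)).
    apply/funext => s /=.
    have -> : k *: (s *: v + x) = (k * s) *: v + k *: x by rewrite scalerDr scalerA.
    by rewrite [in LHS]/GRing.scale [in RHS]/GRing.scale/= invfM !mulrA divff ?gt_eqF// mul1r.
  have dphi' : (fun h : R => h^-1 *: ((phi \o shift (k *: x)) (h *: v) - phi (k *: x))) @ 0^' -->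
    'D_v phi (k *: x) by exact: dphi.
  (* The substitution must preserve punctured neighbourhoods, because the limit of the quotient
     excludes the increment 0. *)
  have kdnbhs : (k * s) @[s --> (0 : R)^'] --> (0 : R)^'.
    move=> A; rewrite /dnbhs /within/= => hA.
    have c : (k * s) @[s --> (0 : R)] --> (0 : R).
      by rewrite -[X in _ --> X](mulr0 k); apply: cvgMl_tmp; exact: cvg_id.
    have := c _ hA; apply: (@filterS _ (nbhs (0 : R))) => s /= h s0; apply: h.
    by rewrite mulf_neq0// gt_eqF.
  apply: cvgMl_tmp; exact: (cvg_comp (fun s : R => k * s) _ kdnbhs dphi').
by apply: DeriveDef; [exact: cvgP H|exact: cvg_lim H].
Qed.

Lemma partial_scale (A k : R) phi i : 0 < k ->
  (forall x, derivable phi x (basis3 i)) ->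
  (forall x, derivable (fun x => A * phi (k *: x)) x (basis3 i)) /\
  partial i (fun x => A * phi (k *: x)) = (fun x => (A * k) * partial i phi (k *: x)).
Proof.
move=> k0 dphi.
have H x : is_derive x (basis3 i) (fun x => A * phi (k *: x))
    ((A * k) * partial i phi (k *: x)).
  rewrite -mulrA; apply: is_deriveZ; exact: is_derive_scale.
split=> [x|]; first exact: ex_derive.
by apply/funext => x; rewrite /partial derive_val.
Qed.

Lemma continuous_scaled (A k : R) phi : continuous phi ->
  continuous (fun x : R3 R => A * phi (k *: x)).
Proof.
move=> cphi x; apply: cvgMl_tmp.
apply: (@cvg_comp _ _ _ (fun x : R3 R => k *: x) phi); last exact: cphi.
exact: continuous_scale_R3.
Qed.

Lemma Ck_scale (A k : R) n phi : 0 < k -> Ck n phi -> Ck n (fun x => A * phi (k *: x)).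
Proof.
move=> k0; elim: n A phi => [|n IH] A phi /=; first exact: continuous_scaled.
move=> [cphi dphi]; split; first exact: continuous_scaled.
move=> i; have [dphii Cphii] := dphi i.
by have [? ->] := partial_scale A k0 dphii; split => //; exact: IH.
Qed.

Lemma test_function_scale (k : R) phi : 0 < k -> test_function phi ->
  test_function (fun x => phi (k *: x)).
Proof.
move=> k0 [Cphi cK]; split=> [n|].
  have -> : (fun x => phi (k *: x)) = (fun x => 1 * phi (k *: x)).
    by apply/funext => x; rewrite mul1r.
  exact: Ck_scale.
apply: (@compact_closure_sub _ _ ((fun x : R3 R => k^-1 *: x) @` closure [set x | phi x != 0])).
  move=> x /= px; exists (k *: x); first exact: subset_closure.
  by rewrite scalerA mulVf ?scale1r// gt_eqF.
apply: continuous_compact => //; apply: continuous_subspaceT.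
exact: continuous_scale_R3.
Qed.

Lemma integrable_scale (k : R) (f : R3 R -> \bar R) : 0 < k ->
  leb3.-integrable setT f -> leb3.-integrable setT (fun x => f (k *: x)).
Proof.
move=> k0 /integrableP[mf fi]; apply/integrableP; split.
  exact: (measurableT_comp mf (measurable_scale_R3 k)).
have maf : measurable_fun setT (abse \o f) by exact: measurableT_comp.
have := ge0_integral_scale k0 maf (fun x => abse_ge0 (f x)).
rewrite /= => ->; rewrite lte_mul_pinfty// ?lee_fin ?invr_ge0 ?exprn_ge0 ?(ltW k0)//.
Qed.

Lemma locally_integrable3_scale (A k : R) u : 0 < k -> locally_integrable3 u ->
  locally_integrable3 (fun x => A * u (k *: x)).
Proof.
move=> k0 [mu ui].
have muk : measurable_fun setT (fun x : R3 R => A * u (k *: x)).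
  apply: measurable_funM => //; exact: (measurableT_comp mu (measurable_scale_R3 k)).
split=> // K cK; have mK := compact_measurable_R3 cK.
apply/(integrable_mkcond _ mK).
pose B := (fun x : R3 R => k *: x) @` K.
have cB : compact B.
  apply: continuous_compact => //; apply: continuous_subspaceT.
  exact: continuous_scale_R3.
have mB := compact_measurable_R3 cB.
have := integrableZl mB A (ui _ cB).
move/(integrable_mkcond _ mB)/(integrable_scale k0); congr (integrable _ _ _).
apply/funext => x; rewrite !patchE.
have -> : (k *: x \in B) = (x \in K).
  apply/idP/idP; rewrite !inE; last by move=> Kx; exists x.
  move=> [y Ky /(congr1 (fun z => k^-1 *: z))].
  by rewrite !scalerA mulVf ?gt_eqF// !scale1r => <-.
by case: ifP.
Qed.

(** After y = k x, testing against [phi] becomes testing the original identity against the dilated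
    test function [psi]; the extra factor k is the derivative of the dilation. *)
Lemma is_weak_partial_scale (A k : R) i u g : 0 < A -> 0 < k -> is_weak_partial i u g ->
  is_weak_partial i (fun x => A * u (k *: x)) (fun x => A * k * g (k *: x)).
Proof.
move=> A0 k0 [lu lg ug]; split; [exact: locally_integrable3_scale..|].
move=> phi tphi.
have kV0 : 0 < k^-1 by rewrite invr_gt0.
pose psi x := phi (k^-1 *: x).
have tpsi : test_function psi by exact: test_function_scale.
have phiE x : phi x = psi (k *: x) by rewrite /psi scalerA mulVf ?scale1r// gt_eqF.
have dpsi x : derivable psi x (basis3 i) by have [/(_ 1%N)/= [_ /(_ i) []]] := tpsi.
have pphiE x : partial i phi x = k * partial i psi (k *: x).
  have [_ /(congr1 (fun f => f x))] := partial_scale 1 k0 dpsi.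
  rewrite mul1r => <-; congr (partial _ _ _).
  by apply/funext => y; rewrite mul1r.
have mu : measurable_fun setT u by case: lu.
have mg : measurable_fun setT g by case: lg.
have mpsi : measurable_fun setT psi by apply: continuous_measurable_R3; exact: test_function_continuous.
have mpartial : measurable_fun setT (partial i psi) by apply: continuous_measurable_R3; exact: partial_continuous.
have Ak0 : 0 < A * k by exact: mulr_gt0.
have mupsi : measurable_fun setT (fun y => u y * partial i psi y) by exact: measurable_funM.
have mgpsi : measurable_fun setT (fun y => g y * psi y) by exact: measurable_funM.
transitivity (\int[leb3]_x (A * k * (fun y => u y * partial i psi y) (k *: x))).
  by apply: eq_Rintegral => x _; rewrite pphiE; ring.
rewrite gt0_RintegralZl//; last exact: (measurableT_comp mupsi (measurable_scale_R3 k)).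
rewrite (Rintegral_scale k0 mupsi) ug//.
transitivity (- \int[leb3]_x (A * k * (fun y => g y * psi y) (k *: x))); last first.
  by congr (- _); apply: eq_Rintegral => x _; rewrite phiE; ring.
rewrite gt0_RintegralZl//; last exact: (measurableT_comp mgpsi (measurable_scale_R3 k)).
by rewrite (Rintegral_scale k0 mgpsi); ring.
Qed.

End weak_calculus.

(** * L^s norms and dominated convergence in them *)

Section Lp_norms.
Context d (T : measurableType d) {R : realType} (m : {measure set T -> \bar R}).
Implicit Types (f g h : T -> R).
Local Notation N s f := (Lnorm m (s%R%:E) (EFin \o f%R)).

Lemma mem_LfunP (s : R) f : f \in Lfun m s%:E <->
  measurable_fun setT f /\ (N s f < +oo)%E.
Proof.
split; first by move=> /andP[]; rewrite !inE.
by move=> [mf ff]; apply/andP; split; rewrite inE.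
Qed.

Lemma LnormE (s : R) f : N s f = ((\int[m]_x (`|f x| `^ s)%:E) `^ s^-1)%E.
Proof. by rewrite unlock. Qed.

Lemma measurable_powR_norm (s : R) f : measurable_fun setT f ->
  measurable_fun setT (fun x => (`|f x| `^ s)%:E).
Proof.
move=> mf; apply/measurable_EFinP.
apply: (@measurableT_comp _ _ _ _ _ _ (fun x : R => x `^ s)) => //.
exact: measurableT_comp.
Qed.

Lemma Lnorm_lty (s : R) f : 0 < s ->
  ((N s f < +oo) <-> (\int[m]_x (`|f x| `^ s)%:E < +oo))%E.
Proof.
move=> s0; rewrite LnormE; split; last exact: poweR_lty.
by apply: lty_poweRy; rewrite gt_eqF// invr_gt0.
Qed.

Lemma Lnorm_le_mono (s : R) f g : 0 < s ->
  measurable_fun setT f -> measurable_fun setT g ->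
  (forall x, `|f x| <= `|g x|) -> (N s f <= N s g)%E.
Proof.
move=> s0 mf mg fg; rewrite !LnormE.
have i0 h : (\int[m]_x (`|h x| `^ s)%:E)%E \in `[0%E, +oo%E].
  by rewrite in_itv/= leey andbT; apply: integral_ge0 => x _; rewrite lee_fin powR_ge0.
apply: gt0_ler_poweR => //; first by rewrite invr_ge0 ltW.
apply: ge0_le_integral => //.
- exact: measurable_powR_norm.
- exact: measurable_powR_norm.
- by move=> x _; rewrite lee_fin ge0_ler_powR// ?nnegrE// ltW.
Qed.

Lemma Lnorm_ae (s : R) f g : measurable_fun setT f -> measurable_fun setT g ->
  {ae m, forall x, f x = g x} -> N s f = N s g.
Proof.
move=> mf mg fg; rewrite !LnormE; congr (_ `^ _)%E.
apply: ae_eq_integral => //; try exact: measurable_powR_norm.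
by apply: filterS fg => x -> _.
Qed.

Lemma Lnorm_sub (s : R) f g h : 1 <= s -> measurable_fun setT f ->
  measurable_fun setT g -> measurable_fun setT h ->
  (N s (f \- h) <= N s (f \- g) + N s (g \- h))%E.
Proof.
move=> s1 mf mg mh.
have -> : f \- h = (f \- g) \+ (g \- h) by apply/funext => x /=; rewrite addrA subrK.
by apply: minkowski_EFin => //; exact: measurable_funB.
Qed.

Lemma LnormN (s : R) f : N s (fun x => - f x) = N s f.
Proof. by rewrite !LnormE; under eq_integral do rewrite normrN. Qed.

Lemma Lnorm_subC (s : R) f g : N s (f \- g) = N s (g \- f).
Proof. by rewrite -LnormN; apply: eq_Lnorm => x /=; rewrite opprB. Qed.

Lemma LnormMl (s k : R) f : 0 < s -> measurable_fun setT f ->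
  N s (fun x => k * f x) = (`|k|%:E * N s f)%E.
Proof.
move=> s0 mf; rewrite !LnormE.
under eq_integral do rewrite normrM powRM// EFinM.
rewrite ge0_integralZl ?lee_fin ?powR_ge0//; last exact: measurable_powR_norm.
rewrite poweRM ?lee_fin ?powR_ge0//; last first.
  by apply: integral_ge0 => x _; rewrite lee_fin powR_ge0.
by rewrite poweR_EFin -powRrM divff ?gt_eqF// powRr1.
Qed.

Lemma cvge0P (x_ : (\bar R)^nat) : (forall n, 0 <= x_ n)%E ->
  (forall e : R, 0 < e -> \forall n \near \oo, (x_ n <= e%:E)%E) -> x_ @ \oo --> 0%E.
Proof.
move=> x0 xe; apply/fine_cvgP.
have xfin : \forall n \near \oo, x_ n \is a fin_num.
  apply: filterS (xe 1 ltr01) => n h; rewrite ge0_fin_numE//.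
  by rewrite (le_lt_trans h)// ltry.
split=> //; apply/cvgrPdist_le => e e0; near=> n.
rewrite sub0r normrN ger0_norm ?fine_ge0//= -lee_fin fineK; first by near: n; exact: xe.
by near: n.
Unshelve. all: by end_near. Qed.

Lemma cvge0_near (x_ : (\bar R)^nat) (e : R) : 0 < e -> x_ @ \oo --> 0%E ->
  \forall n \near \oo, (x_ n <= e%:E)%E.
Proof.
move=> e0 /fine_cvgP[fin /cvgrPdist_le/(_ e e0) h]; near=> n.
have xn : x_ n \is a fin_num by near: n.
rewrite -(fineK xn) lee_fin; apply: le_trans (ler_norm _) _.
by rewrite -normrN -sub0r; near: n.
Unshelve. all: by end_near. Qed.

Lemma Lnorm_cvg0 (s : R) (f_ : (T -> R)^nat) : 0 < s ->
  (\int[m]_x (`|f_ n x| `^ s)%:E @[n --> \oo] --> 0)%E ->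
  (N s (f_ n) @[n --> \oo] --> 0)%E.
Proof.
move=> s0 h; apply: cvge0P => [n|e e0]; first exact: Lnorm_ge0.
have := cvge0_near (powR_gt0 s e0) h; apply: filterS => n hn.
rewrite LnormE.
rewrite (_ : e%:E = (e `^ s)%:E `^ s^-1)%E; last first.
  by rewrite poweR_EFin -powRrM divff ?gt_eqF// powRr1// ltW.
apply: gt0_ler_poweR => //; first by rewrite invr_ge0 ltW.
- by rewrite in_itv/= leey andbT; apply: integral_ge0 => x _; rewrite lee_fin powR_ge0.
- by rewrite in_itv/= leey andbT lee_fin powR_ge0.
Qed.

Lemma Lp_dominated (s : R) (f_ : (T -> R)^nat) f g : 1 <= s ->
  (forall n, measurable_fun setT (f_ n)) -> measurable_fun setT f ->
  g \in Lfun m s%:E -> (forall n x, `|f_ n x| <= g x) -> 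
  (forall x, f_ n x @[n --> \oo] --> f x) ->
  (N s (f_ n \- f) @[n --> \oo] --> 0)%E.
Proof.
move=> s1 mf_ mf /mem_LfunP[mg gfin] fg fcvg.
have s0 : 0 < s by exact: lt_le_trans s1.
have fg' x : `|f x| <= g x.
  have hx : `|f_ n x| @[n --> \oo] --> `|f x| by apply: cvg_norm; exact: fcvg.
  by apply: (cvgr_to_le hx); apply: nearW => n.
apply: Lnorm_cvg0 => //.
have g0 x : 0 <= g x by exact: le_trans (fg' x).
have [] := @dominated_convergence _ _ _ m setT measurableT
  (fun n x => (`|f_ n x - f x| `^ s)%:E) (cst 0%E) (fun x => (`|2 * g x| `^ s)%:E).
- by move=> n; apply: measurable_powR_norm; exact: measurable_funB.
- exact: measurable_cst.
- apply: aeW => x _; apply: cvg_EFin; first exact: nearW.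
  have h : f_ n x - f x @[n --> \oo] --> 0.
    by rewrite -(subrr (f x)); apply: cvgB => //; exact: cvg_cst.
  have {}h : `|f_ n x - f x| @[n --> \oo] --> 0.
    by rewrite -[X in _ --> X](normr0 R); apply: cvg_norm.
  (* Once the difference is at most 1, its power with exponent s >= 1 lies below the difference
     itself, which gives the squeeze. *)
  apply: (@squeeze_cvgr _ _ _ _ (cst 0) (fun n => `|f_ n x - f x|)) => //; last exact: cvg_cst.
  near=> n; rewrite powR_ge0/=.
  have [->|nz] := eqVneq `|f_ n x - f x| 0; first by rewrite powR0// gt_eqF.
  rewrite ge1r_powR// lt_neqAle eq_sym nz normr_ge0/=.
  near: n; exact: (cvgr_le _ h).
- apply/integrableP; split; first by apply: measurable_powR_norm; exact: measurable_funM.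
  under eq_integral do rewrite gee0_abs ?lee_fin ?powR_ge0//.
  apply/Lnorm_lty => //; rewrite LnormMl// lte_mul_pinfty// lee_fin//.
- apply: aeW => x n _; rewrite gee0_abs ?lee_fin ?powR_ge0//.
  rewrite ge0_ler_powR ?nnegrE// ?(ltW s0)//.
  rewrite (le_trans (ler_normB _ _))// (ger0_norm (mulr_ge0 _ _))//.
  by have := fg n x; have := fg' x; lra.
by move=> _ _; rewrite integral0.
Unshelve. all: by end_near. Qed.

End Lp_norms.

(** * Continuity of dilations in L^p *)

Section dilations.
Context {R : realType}.
Variables (p : R) (p1 : 1 <= p).
Implicit Types (f g h u v : R3 R -> R).
Local Notation N s f := (Lnorm leb3 (s%R%:E) (EFin \o f%R)).

Let p0 : 0 < p. Proof. exact: lt_le_trans p1. Qed.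

Lemma measurable_scaled k u : measurable_fun setT u ->
  measurable_fun setT (fun x : R3 R => u (k *: x)).
Proof. by move=> mu; exact: (measurableT_comp mu (measurable_scale_R3 k)). Qed.

Lemma Lnorm_scale (s k : R) u : 0 < s -> 0 < k -> measurable_fun setT u ->
  (N s (fun x => u (k *: x)) = (k `^ (- (3 / s)))%:E * N s u)%E.
Proof.
move=> s0 k0 mu; rewrite !LnormE.
rewrite (ge0_integral_scale (f := fun x => (`|u x| `^ s)%:E) k0); last 2 first.
- exact: measurable_powR_norm.
- by move=> x; rewrite lee_fin powR_ge0.
rewrite poweRM ?lee_fin ?invr_ge0 ?exprn_ge0 ?(ltW k0)//; last first.
  by apply: integral_ge0 => x _; rewrite lee_fin powR_ge0.
rewrite poweR_EFin; congr (_%:E * _)%E.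
by rewrite -powR_invn ?ltW// -powRrM mulNr.
Qed.

(** The L^p norm of a dilate carries the factor k^(-3/p), bounded only away from k = 0; hence the
    lower bound [kappa]. Sequences give direct access to dominated convergence. *)
Definition dilation_continuous u := measurable_fun setT u /\
  forall (k_ : nat -> R) (k kappa : R), 0 < kappa -> (forall n, kappa <= k_ n) ->
  kappa <= k -> k_ n @[n --> \oo] --> k ->
  (N p ((fun x => u (k_ n *: x)) \- (fun x => u (k *: x)))%R @[n --> \oo] --> 0)%E.

Lemma dilation_continuousD u v : dilation_continuous u -> dilation_continuous v ->
  dilation_continuous (u \+ v).
Proof.
move=> [mu cu] [mv cv]; split; first exact: measurable_funD.
move=> k_ k kappa kappa0 k_kappa kkappa kk.
have {}cu := cu _ _ _ kappa0 k_kappa kkappa kk.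
have {}cv := cv _ _ _ kappa0 k_kappa kkappa kk.
apply: cvge0P => [n|e e0]; first exact: Lnorm_ge0.
have e20 : 0 < e / 2 by rewrite divr_gt0.
near=> n.
apply: (@le_trans _ _ (N p ((fun x => u (k_ n *: x)) \- (fun x => u (k *: x)))%R +
   N p ((fun x => v (k_ n *: x)) \- (fun x => v (k *: x)))%R)%E).
  rewrite [X in (X <= _)%E](_ : _ = N p (((fun x => u (k_ n *: x)) \- (fun x => u (k *: x))) \+
     ((fun x => v (k_ n *: x)) \- (fun x => v (k *: x))))).
    by apply: minkowski_EFin => //; apply: measurable_funB; exact: measurable_scaled.
  by apply: eq_Lnorm => x /=; congr EFin; ring.
rewrite (_ : e = e / 2 + e / 2); last by rewrite -splitr.
rewrite EFinD leeD//; near: n; exact: cvge0_near.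
Unshelve. all: by end_near. Qed.

Lemma dilation_continuousMl (a : R) u : dilation_continuous u ->
  dilation_continuous (fun x => a * u x).
Proof.
move=> [mu cu]; split; first exact: measurable_funM.
move=> k_ k kappa kappa0 k_kappa kkappa kk.
have {}cu := cu _ _ _ kappa0 k_kappa kkappa kk.
rewrite (_ : (fun n => _) = (fun n => `|a|%:E *
  N p ((fun x => u (k_ n *: x)) \- (fun x => u (k *: x)))%R)%E).
  by rewrite -[X in _ --> X](mule0 `|a|%:E); apply: cvgeZl.
apply/funext => n; rewrite -LnormMl//.
  by apply: eq_Lnorm => x /=; rewrite mulrBr.
by apply: measurable_funB; exact: measurable_scaled.
Qed.

(** Three-epsilon argument: dilations with ratio at least [kappa] have operator norm at most M =
    kappa^(-3/p), so an approximation within e/(3M) stays within e/3 after any of them. *)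
Lemma dilation_continuous_approx u : measurable_fun setT u ->
  (forall e : R, 0 < e -> exists2 v, dilation_continuous v & (N p (u \- v) <= e%:E)%E) ->
  dilation_continuous u.
Proof.
move=> mu au; split=> // k_ k kappa kappa0 k_kappa kkappa kk.
apply: cvge0P => [n|e e0]; first exact: Lnorm_ge0.
pose M := kappa `^ (- (3 / p)).
have M0 : 0 < M by exact: powR_gt0.
have MP (r : R) : kappa <= r -> r `^ (- (3 / p)) <= M.
  move=> kr; have r0 : 0 < r by exact: lt_le_trans kr.
  rewrite /M !powRN lef_pV2 ?posrE ?powR_gt0//.
  by apply: ge0_ler_powR => //; rewrite ?nnegrE ?divr_ge0 ?(ltW p0) ?(ltW r0) ?(ltW kappa0).
have e30 : 0 < e / 3 / M by rewrite !divr_gt0.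
have [v [mv cv] uv] := au _ e30.
have scaleP (r : R) : kappa <= r ->
    (N p ((fun x => u (r *: x)) \- (fun x => v (r *: x)))%R <= (e / 3)%:E)%E.
  move=> kr; have r0 : 0 < r by exact: lt_le_trans kr.
  rewrite (Lnorm_scale (u := u \- v) p0 r0); last exact: measurable_funB.
  apply: (@le_trans _ _ (M%:E * (e / 3 / M)%:E)%E).
    by apply: lee_pmul => //; [rewrite lee_fin powR_ge0|exact: Lnorm_ge0|rewrite lee_fin MP].
  by rewrite -EFinM lee_fin mulrC divfK// gt_eqF.
have {}cv := cv _ _ _ kappa0 k_kappa kkappa kk.
near=> n.
have m1 := measurable_scaled (k_ n) mu; have m2 := measurable_scaled k mu.
have m3 := measurable_scaled (k_ n) mv; have m4 := measurable_scaled k mv.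
apply: le_trans (Lnorm_sub leb3 p1 m1 m3 m2) _.
rewrite (_ : e = e / 3 + (e / 3 + e / 3)); last by field.
rewrite EFinD leeD//; first exact: scaleP.
apply: le_trans (Lnorm_sub leb3 p1 m3 m4 m2) _.
rewrite EFinD leeD//; last by rewrite Lnorm_subC; exact: scaleP.
by near: n; apply: cvge0_near => //; rewrite divr_gt0.
Unshelve. all: by end_near. Qed.

Lemma dilation_continuous_cvg u (u_ : nat -> R3 R -> R) : measurable_fun setT u ->
  (forall n, dilation_continuous (u_ n)) -> (N p (u_ n \- u) @[n --> \oo] --> 0)%E ->
  dilation_continuous u.
Proof.
move=> mu cu_ h; apply: dilation_continuous_approx => // e e0.
have [n _ hn] := cvge0_near e0 h.
by exists (u_ n) => //; rewrite Lnorm_subC; exact: hn (leqnn n).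
Qed.

Lemma Lfun_indic (A : set (R3 R)) : measurable A -> (leb3 A < +oo)%E ->
  (\1_A : R3 R -> R) \in Lfun leb3 p%:E.
Proof.
move=> mA Afin; apply/mem_LfunP; split=> //.
apply/Lnorm_lty => //.
rewrite (_ : (fun x => _) = (fun x => (\1_A x)%:E)).
  by rewrite integral_indic// setIT.
apply/funext => x; rewrite indicE; case: (x \in A) => /=.
  by rewrite normr1 powR1.
by rewrite normr0 powR0// gt_eqF.
Qed.

Lemma dilation_continuous_box_bump a b n : dilation_continuous (box_bump a b n).
Proof.
have cbb := @continuous_box_bump R a b n.
have mbb := continuous_measurable_R3 cbb.
split=> // k_ k kappa kappa0 k_kappa kkappa kk.
(* [S] bounds every coordinate of the two corners. Any dilate with ratio at least [kappa] is then
   supported in the cube of half-side M > S/kappa, whose indicator dominates all of them. *)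
pose S := `|a.1.1| + `|a.1.2| + `|a.2| + `|b.1.1| + `|b.1.2| + `|b.2|.
pose M := (Num.truncn (S / kappa)).+1.
have SM : S < kappa * M%:R by rewrite mulrC -ltr_pdivrMr//; exact: truncnS_gt.
have inM (r y z t : R) : kappa <= r -> `|y| <= S -> `|z| <= S -> r * t \in `]y, z[ ->
    t \in `](- M%:R), M%:R[.
  move=> kr yS zS; rewrite !in_itv/= -ltr_norml => /andP[yt tz].
  have r0 : 0 < r by exact: lt_le_trans kr.
  have : `|r * t| < kappa * M%:R.
    apply: le_lt_trans SM; rewrite ler_norml; apply/andP; split.
      by rewrite lerNl; apply: le_trans yS; rewrite -normrN; apply: le_trans (ler_norm _);
        rewrite lerN2 ltW.
    by apply: le_trans zS; exact: le_trans (ltW tz) (ler_norm _).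
  rewrite normrM (gtr0_norm r0) => h.
  have : kappa * `|t| < kappa * M%:R by apply: le_lt_trans h; rewrite ler_wpM2r.
  by rewrite ltr_pM2l.
have norm_S : [/\ `|a.1.1| <= S, `|a.1.2| <= S, `|a.2| <= S &
    [/\ `|b.1.1| <= S, `|b.1.2| <= S & `|b.2| <= S]].
  rewrite /S; move: (normr_ge0 a.1.1) (normr_ge0 a.1.2) (normr_ge0 a.2).
  move: (normr_ge0 b.1.1) (normr_ge0 b.1.2) (normr_ge0 b.2).
  by move=> ? ? ? ? ? ?; do !split; lra.
have dom r x : kappa <= r -> `|box_bump a b n (r *: x)| <= \1_(cube M) x.
  move=> kr; have [xb|/(box_bump_out n)->] := pselect (obox a b (r *: x)); last first.
    by rewrite normr0 indicE.
  have /andP[h1 h2] := box_bump_itv a b n (r *: x).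
  rewrite ger0_norm// (le_trans h2)// indicE mem_set//.
  case: xb => -[/= h3 h4] h5; case: norm_S => a1 a2 a3 [b1 b2 b3].
  split; first split.
  - exact: inM kr a1 b1 h3.
  - exact: inM kr a2 b2 h4.
  - exact: inM kr a3 b3 h5.
apply: (@Lp_dominated _ _ _ _ _ _ _ (\1_(cube M))) => //.
- by move=> i; exact: measurable_scaled.
- exact: measurable_scaled.
- by apply: Lfun_indic; [exact: measurable_obox|exact: leb3_obox].
- by move=> i x; exact: dom.
move=> x; apply: (@cvg_comp _ _ _ (fun i => k_ i *: x) (box_bump a b n)); last exact: cbb.
by apply: cvgZr_tmp.
Qed.

Lemma dilation_continuous_obox a b : dilation_continuous (\1_(obox a b)).
Proof.
have mo := @measurable_obox R a b.
apply: (dilation_continuous_cvg (u_ := box_bump a b)) => //.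
  exact: dilation_continuous_box_bump.
apply: (@Lp_dominated _ _ _ _ _ _ _ (\1_(obox a b))) => //.
- by move=> n; have [] := dilation_continuous_box_bump a b n.
- by apply: Lfun_indic; [exact: measurable_obox|exact: leb3_obox].
- move=> n x; have /andP[h1 h2] := box_bump_itv a b n x.
  rewrite ger0_norm// indicE; have [_|] := boolP (x \in _); first exact: h2.
  by rewrite notin_setE => /(box_bump_out n) ->.
exact: cvg_box_bump.
Qed.

Lemma indic_setI (A B : set (R3 R)) x : \1_(A `&` B) x = \1_A x * \1_B x :> R.
Proof. by rewrite indicI. Qed.

(** The cube keeps measures finite: its indicator lies in L^p and dominates the increasing unions of
    the lambda-system, while set differences become differences of indicators. *)
Lemma dilation_continuous_indic (N : nat) (A : set (R3 R)) : measurable A ->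
  dilation_continuous (\1_(A `&` cube N)).
Proof.
have mC : measurable (@cube R N) by exact: measurable_obox.
pose H := [set A : set (R3 R) | measurable A /\ dilation_continuous (\1_(A `&` cube N))].
suff HA : forall A, measurable A -> H A by move=> /HA[].
apply: lambda_system_R3; last first.
  move=> _ [a _ [b _ <-]]; split; first exact: measurable_obox.
  have [c _ [d _ <-]] : oboxes (obox a b `&` cube N).
    by apply: obox_setI_closed; eexists => //; eexists.
  exact: dilation_continuous_obox.
split=> //.
- by split=> //; rewrite setTI; exact: dilation_continuous_obox.
- move=> B C CB [mB HB] [mC' HC]; split; first exact: measurableD.
  rewrite (_ : \1_((B `\` C) `&` cube N) = (\1_(B `&` cube N) \+ (fun x => -1 * \1_(C `&` cube N) x))%R :> (R3 R -> R)).
    by apply: dilation_continuousD => //; exact: dilation_continuousMl.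
  apply/funext => x /=; rewrite (indic_setI (B `\` C)) (indic_setI B) (indic_setI C) mulrA -mulrDl; congr (_ * _).
  rewrite !indicE.
  have [xC|xC] := boolP (x \in C).
    rewrite (_ : x \in B = true); last by apply/mem_set/CB/set_mem.
    rewrite memNset; last by move=> -[_]; apply; exact/set_mem.
    by rewrite mulN1r subrr.
  rewrite mulr0 addr0; congr (_%:R); congr nat_of_bool.
  apply/idP/idP; rewrite !inE; first by case.
  by move=> Bx; split => //; move: xC; rewrite notin_setE.
- move=> F ndF HF.
  have mF n : measurable (F n) by case: (HF n).
  have mU : measurable (\bigcup_n F n) by exact: bigcupT_measurable.
  split=> //.
  apply: (dilation_continuous_cvg (u_ := fun n => \1_(F n `&` cube N))).
  + by apply: measurable_indic; exact: measurableI.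
  + by move=> n; case: (HF n).
  apply: (@Lp_dominated _ _ _ _ _ _ _ (\1_(cube N))) => //.
  + by move=> n; apply: measurable_indic; exact: measurableI.
  + by apply: measurable_indic; exact: measurableI.
  + by apply: Lfun_indic => //; exact: leb3_obox.
  + move=> n x; rewrite (indic_setI (F n)) normrM !indicE !normr_nat.
    by rewrite ler_piMl// lern1 leq_b1.
  + move=> x; apply: cvg_near_cst.
    have [[m _ Fmx]|nF] := pselect ((\bigcup_n F n) x).
      apply: filterS (nbhs_infty_ge m) => n mn; rewrite (indic_setI (F n)) (indic_setI (\bigcup_n F n)) [\1_(F n) _]indicE [\1_(\bigcup_n F n) _]indicE.
      rewrite (mem_set (A := \bigcup_n F n)); last by exists m.
      by rewrite mem_set//; move/subsetPset : (ndF m n mn); apply.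
    apply: nearW => n; rewrite (indic_setI (F n)) (indic_setI (\bigcup_n F n)) [\1_(F n) _]indicE [\1_(\bigcup_n F n) _]indicE.
    rewrite (memNset nF) memNset//.
    by move=> Fnx; apply: nF; exists n.
Qed.

Lemma dilation_continuous_sum (I : Type) (s : seq I) (F : I -> R3 R -> R) :
  (forall i, dilation_continuous (F i)) ->
  dilation_continuous (fun x => \sum_(i <- s) F i x).
Proof.
move=> cF; elim: s => [|i s IH].
  rewrite (_ : (fun x => _) = (fun x => 0 * \1_(obox 0 0) x)).
    by apply: dilation_continuousMl; exact: dilation_continuous_obox.
  by apply/funext => x; rewrite big_nil mul0r.
rewrite (_ : (fun x => _) = F i \+ (fun x => \sum_(i <- s) F i x)).
  exact: dilation_continuousD.
by apply/funext => x; rewrite big_cons.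
Qed.

Import HBNNSimple.

Lemma dilation_continuous_nnsfun (N : nat) (f : {nnsfun (R3 R) >-> R}) :
  dilation_continuous (fun x => f x * \1_(cube N) x).
Proof.
rewrite (_ : (fun x => _) = (fun x =>
    \sum_(y <- finmap.enum_fset (fset_set (range f))) y * \1_(f @^-1` [set y] `&` cube N) x)).
  apply: dilation_continuous_sum => y; apply: dilation_continuousMl.
  by apply: dilation_continuous_indic; exact: measurable_sfunP.
apply/funext => x; rewrite fimfunE fsbig_finite//= mulr_suml.
by apply: eq_bigr => y _; rewrite -mulrA (indic_setI (f @^-1` [set y])).
Qed.

Lemma dilation_continuous_ge0 u : u \in Lfun leb3 p%:E -> (forall x, 0 <= u x) ->
  dilation_continuous u.
Proof.
move=> /[dup] Lu /mem_LfunP[mu ufin] u0.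
have meu : measurable_fun setT (EFin \o u) by exact/measurable_EFinP.
pose g := nnsfun_approx measurableT meu.
have eu0 x : setT x -> (0 <= (EFin \o u) x)%E by rewrite /= lee_fin.
(* One index drives both the simple approximation and the cube truncating it; the products stay
   below [u], which serves as its own dominating function. *)
apply: (dilation_continuous_cvg (u_ := fun n x => g n x * \1_(cube n) x)) => //.
  by move=> n; exact: dilation_continuous_nnsfun.
apply: (@Lp_dominated _ _ _ _ _ _ _ u) => //.
- by move=> n; case: (dilation_continuous_nnsfun n (g n)).
- move=> n x; rewrite normrM ger0_norm//.
  have gu : g n x <= u x by rewrite /g nnsfun_approxE -lee_fin; exact: le_approx.
  by apply: le_trans gu; rewrite indicE ler_piMr// normr_nat lern1 leq_b1.
move=> x; rewrite -[X in _ --> X]mulr1; apply: cvgM.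
  have := cvg_nnsfun_approx measurableT meu eu0 (I : setT x).
  by move=> /fine_cvgP[_].
apply: cvg_near_cst; apply: filterS (in_cube x) => n Cx.
by rewrite indicE mem_set.
Qed.

Lemma Lfun_dilation_continuous u : u \in Lfun leb3 p%:E -> dilation_continuous u.
Proof.
move=> /[dup] Lu /mem_LfunP[mu ufin].
have mun : measurable_fun setT (fun x => `|u x|) by exact: measurableT_comp.
have LN f : measurable_fun setT f -> (forall x, `|f x| <= `|u x|) -> f \in Lfun leb3 p%:E.
  move=> mf fu; apply/mem_LfunP; split => //.
  by apply: le_lt_trans ufin; exact: Lnorm_le_mono.
pose up x := 2^-1 * (`|u x| + u x); pose un x := 2^-1 * (`|u x| - u x).
have bound x : 0 <= up x <= `|u x| /\ 0 <= un x <= `|u x|.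
  have h1 := ler_norm (u x); have h2 := ler_norm (- u x); rewrite normrN in h2.
  by rewrite /up /un; split; apply/andP; split; lra.
rewrite (_ : u = up \+ (fun x => -1 * un x)); last first.
  by apply/funext => x; rewrite /up /un /=; field.
apply: dilation_continuousD; last apply: dilation_continuousMl.
- apply: dilation_continuous_ge0 => [|x]; last by case: (bound x) => /andP[].
  apply: LN => [|x]; first by apply: measurable_funM => //; exact: measurable_funD.
  by have [/andP[h1 h2] _] := bound x; rewrite ger0_norm.
- apply: dilation_continuous_ge0 => [|x]; last by case: (bound x) => _ /andP[].
  apply: LN => [|x]; first by apply: measurable_funM => //; exact: measurable_funB.
  by have [_ /andP[h1 h2]] := bound x; rewrite ger0_norm.
Qed.

End dilations.

(** * One-variable analysis of the fiber map *)

Section fiber.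
Context {R : realType}.

(** Young's inequality with exponents k and k/(k-1), applied to s and 1, reads s <= s^k/k + 1 -
    1/k. *)
Lemma bernoulli_powR (k s : R) : 1 <= k -> 0 <= s -> 1 + k * (s - 1) <= s `^ k.
Proof.
rewrite le_eqVlt => /predU1P[<-|k1] s0; first by rewrite powRr1//; lra.
have k0 : 0 < k by lra.
pose l := (1 - k^-1)^-1.
have kV : 0 < 1 - k^-1 by rewrite subr_gt0 invf_lt1.
have l0 : 0 < l by rewrite invr_gt0.
have := @conjugate_powR R s 1 k l s0 ler01 k0 l0.
rewrite /l invrK powR1 mulr1 mul1r => /(_ ltac:(ring)).
rewrite -(ler_pM2l k0) mulrDr mulrCA divff ?gt_eqF// mulr1 mulrBr mulr1 divff ?gt_eqF//.
by move=> h; lra.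
Qed.

(** Strictness comes from squaring the weak inequality at r = sqrt s: the square of 1 + k(r-1)
    exceeds 1 + k(r^2-1) by k(k-1)(r-1)^2. *)
Lemma bernoulli_powR_lt (k s : R) : 1 < k -> 0 < s -> s != 1 ->
  1 + k * (s - 1) < s `^ k.
Proof.
move=> k1 s0 s1.
pose r := s `^ 2^-1.
have r0 : 0 < r by exact: powR_gt0.
have sE : s = r ^+ 2.
  by rewrite -powR_mulrn ?(ltW r0)// /r -powRrM mulVf// powRr1// ltW.
have rN1 : r != 1 by apply: contra s1 => /eqP r1; rewrite sE r1 expr1n.
have skE : s `^ k = (r `^ k) ^+ 2.
  by rewrite -powR_mulrn ?powR_ge0// -powRrM mulrC powRrM powR_mulrn ?(ltW r0)// -sE.
have h := bernoulli_powR (ltW k1) (ltW r0).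
have rk0 : 0 < r `^ k by exact: powR_gt0.
rewrite skE sE.
have r12 : 0 < (r - 1) ^+ 2 by rewrite exprn_even_gt0//= subr_eq0.
(* Squaring needs a positive base. Otherwise k(r-1) <= -1, so the left-hand side is at most -r and
   the claim is immediate. *)
have [B0|B0] := lerP (1 + k * (r - 1)) 0; first nra.
have : (1 + k * (r - 1)) ^+ 2 <= (r `^ k) ^+ 2 by rewrite ler_pXn2r// nnegrE ltW.
apply: lt_le_trans; rewrite -subr_gt0.
have -> : (1 + k * (r - 1)) ^+ 2 - (1 + k * (r ^+ 2 - 1)) = k * (k - 1) * (r - 1) ^+ 2 by ring.
by rewrite mulr_gt0// mulr_gt0// ?subr_gt0//; lra.
Qed.

(** [fiber_map] with abstract constants: al = a/p, be = b/(2p), th = 3(q-p)/p^2, and [C] the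
    coefficient called [fiber_coef] below. The two are convertible, so the shape result applies to
    [fiber_map] directly. *)
Definition fiber (al be C th t : R) := al * t + be * t ^+ 2 - C * t `^ th.

Lemma fiber_crit (al be C th : R) : 0 < al -> 0 < be -> 0 < C ->
  (2 < th \/ th = 2 /\ be < C) ->
  exists2 t : R, 0 < t & al + 2 * be * t = C * th * t `^ (th - 1).
Proof.
move=> al0 be0 C0 [th2|[-> beC]]; last first.
  have d0 : 0 < C - be by rewrite subr_gt0.
  (* For th = 2 the derivative is affine, and be < C is what makes its zero positive. *)
  exists (al / (2 * (C - be))); first by rewrite divr_gt0// mulr_gt0.
  rewrite (_ : 2 - 1 = 1); last by ring.
  rewrite powRr1; last by rewrite divr_ge0 ?mulr_ge0 ?ltW.
  by field; rewrite gt_eqF.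
have Cth0 : 0 < C * th by rewrite mulr_gt0//; lra.
have t20 : 0 < th - 2 by lra.
(* For e <= 1 and th > 2 one has e^(th-1) <= e, so e <= al/(2 C th) keeps the subtracted term below
   al/2. *)
have [e e01 he] : exists2 e : R, 0 < e <= 1 & 0 <= al + 2 * be * e - C * th * e `^ (th - 1).
  exists (Num.min 1 (al / (2 * (C * th)))).
    by rewrite ge_min lexx lt_min ltr01 divr_gt0// mulr_gt0.
  have : Num.min 1 (al / (2 * (C * th))) <= al / (2 * (C * th)) by rewrite ge_min lexx orbT.
  have : Num.min 1 (al / (2 * (C * th))) <= 1 by rewrite ge_min lexx.
  have : 0 < Num.min 1 (al / (2 * (C * th))) by rewrite lt_min ltr01 divr_gt0// mulr_gt0.
  move: (Num.min _ _) => e e0 e1; rewrite ler_pdivlMr; last by rewrite mulr_gt0.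
  have h1 : e `^ (th - 1) <= e by apply: ge1r_powR; [rewrite e0|lra].
  have h3 : (C * th) * e `^ (th - 1) <= (C * th) * e by rewrite ler_pM2l.
  have h4 : 0 < be * e by exact: mulr_gt0.
  by move=> h2; lra.
have [M M1 hM] : exists2 M : R, 1 <= M & al + 2 * be * M - C * th * M `^ (th - 1) <= 0.
  (* With M^(th-2) = D, the subtracted term C th M^(th-1) is M(al + 2be + C th), which dominates al
     + 2be M as M >= 1. *)
  have [D D1 DE] : exists2 D : R, 1 <= D & C * th * D = al + 2 * be + C * th.
    exists ((al + 2 * be) / (C * th) + 1).
      by rewrite lerDr divr_ge0//; lra.
    by field; rewrite !gt_eqF//; lra.
  exists (D `^ (th - 2)^-1).
    by rewrite -[leLHS](powRr0 D) ler_powR// invr_ge0 ltW.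
  have M1 : 1 <= D `^ (th - 2)^-1 by rewrite -[leLHS](powRr0 D) ler_powR// invr_ge0 ltW.
  have : (D `^ (th - 2)^-1) `^ (th - 2) = D.
    by rewrite -powRrM mulVf ?gt_eqF// powRr1//; lra.
  move: (D `^ _) M1 => M M1 MD.
  have M0 : 0 < M by lra.
  have -> : M `^ (th - 1) = M * D.
    rewrite -MD -{2}(powRr1 (ltW M0)) -powRD; last by rewrite (gt_eqF M0) implybT.
    by congr (_ `^ _); ring.
  rewrite mulrCA DE.
  have h5 : al <= M * al by rewrite ler_peMl// ltW.
  have h6 : 0 < M * (C * th) by rewrite mulr_gt0.
  by lra.
case/andP: e01 => e0 e1; have eM : e <= M by lra.
have ch : {within `[e, M], continuous (fun t => al + 2 * be * t - C * th * t `^ (th - 1))}.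
  apply: derivable_within_continuous => x; rewrite in_itv/= => /andP[ex _].
  have x0 : 0 < x by lra.
  apply: derivableB; first by apply: derivableD => //; apply: derivableM.
  apply: derivableM => //; apply: derivable_powR; by rewrite in_itv/= x0.
have [|t] := IVT (v := 0) eM ch.
  by rewrite ge_min hM orbT /= le_max he.
rewrite in_itv/= => /andP[et _] ht; exists t; first lra.
by move/eqP : ht; rewrite subr_eq0 => /eqP.
Qed.

(** The critical equation eliminates [C], and what remains is two copies of z - z^k/k, with (k, z) =
    (th, r) and (th/2, r^2). For k >= 1 such a function is largest at z = 1, which is where th >= 2
    enters. *)
Lemma fiber_at_crit (al be C th t r : R) : 2 <= th -> 0 < t -> al + 2 * be * t = C * th * t `^ (th - 1) ->
  0 <= r -> fiber al be C th (t * r) = al * t * (r - r `^ th / th) +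
    be * t ^+ 2 * (r ^+ 2 - (r ^+ 2) `^ (th / 2) / (th / 2)).
Proof.
move=> th2 t0 crit r0.
have th0 : th != 0 by rewrite gt_eqF//; lra.
have -> : (r ^+ 2) `^ (th / 2) = r `^ th.
  by rewrite -powR_mulrn// -powRrM; congr (_ `^ _); field.
have E : C * t `^ th = t * (al + 2 * be * t) / th.
  rewrite crit -(mulr_powRB1 (ltW t0)); last lra.
  by field.
rewrite /fiber powRM ?(ltW t0)//.
by rewrite (mulrA C) E; field.
Qed.

Lemma fiber_shape (al be C th : R) : 0 < al -> 0 < be -> 0 < C ->
  (2 < th \/ th = 2 /\ be < C) -> exists t : R,
  [/\ 0 < t, al + 2 * be * t = C * th * t `^ (th - 1),
     forall s, 0 < s -> s != t -> fiber al be C th s < fiber al be C th t,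
     forall s, 0 <= s <= t -> 0 <= fiber al be C th s &
     exists2 t1, t < t1 & fiber al be C th t1 < 0].
Proof.
move=> al0 be0 C0 case; have [t t0 crit] := fiber_crit al0 be0 C0 case.
have th2 : 2 <= th by case: case => [/ltW//|[-> _]].
have th0 : 0 < th by lra.
have scaleE s : s = t * (s / t) by rewrite mulrC divfK// gt_eqF.
exists t; split=> //.
- move=> s s0 st; rewrite (scaleE s) -[in X in _ < X](mulr1 t).
  have r0 : 0 < s / t by rewrite divr_gt0.
  rewrite (fiber_at_crit th2 t0 crit (ltW r0)) (fiber_at_crit th2 t0 crit ler01) expr1n !powR1.
  have r1 : s / t != 1 by apply: contra st => /eqP h; rewrite (scaleE s) h mulr1.
  move: (s / t) r0 r1 => r r0 r1.
  have th1 : 1 < th by lra.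
  (* Only the first summand gives strictness: th/2 may equal 1, and then the second one vanishes
     identically. *)
  apply: ltr_leD.
    rewrite ltr_pM2l ?mulr_gt0//.
    have h := bernoulli_powR_lt th1 r0 r1.
    by rewrite -(ltr_pM2r th0) !mulrBl !divfK ?gt_eqF//; lra.
  rewrite ler_pM2l ?mulr_gt0 ?exprn_gt0//.
  have t2 : 1 <= th / 2 by lra.
  have t20 : 0 < th / 2 by lra.
  have h := bernoulli_powR t2 (sqr_ge0 r).
  by rewrite -(ler_pM2r t20) [leLHS]mulrBl [leRHS]mulrBl !(divfK (lt0r_neq0 t20)); lra.
- move=> s /andP[s0 st]; have r01 : 0 <= s / t <= 1.
    by apply/andP; split; [rewrite divr_ge0// ltW|rewrite ler_pdivrMr// mul1r].
  rewrite (scaleE s) (fiber_at_crit th2 t0 crit (proj1 (andP r01))).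
  move: (s / t) r01 => r /andP[r0 r1].
  have gm (k z : R) : 1 <= k -> 0 <= z <= 1 -> 0 <= z - z `^ k / k.
    move=> k1 /andP[]; rewrite le_eqVlt => /predU1P[<- _|z0 z1].
      by rewrite powR0 ?mul0r ?subrr// gt_eqF//; lra.
    have h : z `^ k <= z by apply: ge1r_powR => //; rewrite z0.
    rewrite subr_ge0 ler_pdivrMr; last lra.
    by apply: (le_trans h); rewrite ler_peMr// ltW.
  rewrite addr_ge0// mulr_ge0 ?mulr_ge0 ?sqr_ge0 ?(ltW al0) ?(ltW be0) ?(ltW t0)//.
    by apply: gm; [lra|rewrite r0].
  by apply: gm; [lra|rewrite sqr_ge0 expr_le1].
(* For th > 2, r^(th-2) = th gives r^th/th = r^2 and turns the second term into r^2 - 2r^2. For th =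
   2 the second term is 0 and r = 3 works, as 9/2 > 3. *)
- have [r r1 [rth rth2]] : exists2 r : R, 1 < r & r < r `^ th / th /\ r ^+ 2 <= (r ^+ 2) `^ (th / 2) / (th / 2).
    case: case => [th2'|[-> _]]; last first.
      exists 3; first lra; split.
        by rewrite powR_mulrn//; lra.
      by rewrite divff// powRr1// divr1.
    have t20 : 0 < th - 2 by lra.
    have : 1 < th `^ (th - 2)^-1.
      rewrite [X in X < _](_ : 1 = 1 `^ (th - 2)^-1); last by rewrite powR1.
      by apply: gt0_ltr_powR; rewrite ?nnegrE ?invr_gt0//; lra.
    have : (th `^ (th - 2)^-1) `^ (th - 2) = th.
      by rewrite -powRrM mulVf ?gt_eqF// powRr1 ?ltW.
    move: (th `^ (th - 2)^-1) => r rE r1.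
    have r0 : 0 < r by lra.
    have rthE : r `^ th = r ^+ 2 * th.
      rewrite -[X in _ * X]rE -powR_mulrn ?(ltW r0)// -powRD ?(gt_eqF r0) ?implybT//.
      by congr (_ `^ _); ring.
    exists r => //; split.
      by rewrite rthE mulfK ?gt_eqF// expr2 ltr_pMr.
    rewrite -[X in _ <= X `^ _ / _](powR_mulrn 2 (ltW r0)) -powRrM (mulrC 2) divfK// rthE.
    rewrite [X in _ <= X](_ : _ = 2 * r ^+ 2); last by field; rewrite gt_eqF.
    have := sqr_ge0 r; lra.
  exists (t * r); first by rewrite ltr_pMr.
  rewrite fiber_at_crit//; last lra.
  have h1 : al * t * (r - r `^ th / th) < 0 by rewrite pmulr_rlt0 ?mulr_gt0// subr_lt0.
  have h2 : be * t ^+ 2 * (r ^+ 2 - (r ^+ 2) `^ (th / 2) / (th / 2)) <= 0.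
    by rewrite pmulr_rle0 ?mulr_gt0 ?exprn_gt0// subr_le0.
  by lra.
Qed.

End fiber.

(** * Real-valued norms and convergence of rescaled functions *)

Section norm_L.
Context {R : realType}.
Implicit Types (f g u v : R3 R -> R) (s k A : R).
Local Notation N s f := (Lnorm leb3 (s%R%:E) (EFin \o f%R)).

Lemma norm_L_ge0 s u : 0 <= norm_L s u.
Proof. by rewrite /norm_L fine_ge0// Lnorm_ge0. Qed.

Lemma norm_LE s u : u \in Lfun leb3 s%:E -> (norm_L s u)%:E = N s u.
Proof.
by move=> /mem_LfunP[_ h]; rewrite /norm_L fineK// ge0_fin_numE// Lnorm_ge0.
Qed.

Lemma norm_L_ae s f g : measurable_fun setT f -> measurable_fun setT g ->
  {ae leb3, forall x, f x = g x} -> norm_L s f = norm_L s g.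
Proof. by move=> mf mg fg; rewrite /norm_L (Lnorm_ae s mf mg fg). Qed.

Lemma norm_L_scale s A k u : 0 < s -> 0 < A -> 0 < k -> measurable_fun setT u ->
  norm_L s (fun x => A * u (k *: x)) = A * (k `^ (- (3 / s)) * norm_L s u).
Proof.
move=> s0 A0 k0 mu; rewrite /norm_L LnormMl//; last exact: measurable_scaled.
by rewrite Lnorm_scale// gtr0_norm// !gt0_fineM// powR_gt0.
Qed.

Lemma norm_L_powR s u : 0 < s -> norm_L s u `^ s = \int[leb3]_x (`|u x| `^ s).
Proof.
by move=> s0; rewrite /norm_L -fine_poweR poweR_Lnorm ?gt_eqF.
Qed.

Lemma Lfun_scaled s A k u : 0 < s -> 0 < k -> u \in Lfun leb3 s%:E ->
  (fun x => A * u (k *: x)) \in Lfun leb3 s%:E.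
Proof.
move=> s0 k0 /mem_LfunP[mu uoo]; apply/mem_LfunP; have muk := measurable_scaled k mu.
split; first exact: measurable_funM.
rewrite LnormMl// Lnorm_scale// lte_mul_pinfty ?lee_fin// lte_mul_pinfty ?lee_fin ?powR_ge0//.
Qed.

Lemma Lfun_sub s u v : 1 <= s -> u \in Lfun leb3 s%:E -> v \in Lfun leb3 s%:E ->
  (u \- v) \in Lfun leb3 s%:E.
Proof.
move=> s1 /mem_LfunP[mu uoo] /mem_LfunP[mv voo]; apply/mem_LfunP.
split; first exact: measurable_funB.
have -> : u \- v = u \+ (fun x => - v x) by [].
apply: le_lt_trans (minkowski_EFin leb3 mu _ s1) _; first exact: measurableT_comp.
by rewrite LnormN lte_add_pinfty.
Qed.

Lemma Lfun_le s u v : 0 < s -> measurable_fun setT u -> v \in Lfun leb3 s%:E ->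
  (forall x, `|u x| <= `|v x|) -> u \in Lfun leb3 s%:E.
Proof.
move=> s0 mu /mem_LfunP[mv voo] uv; apply/mem_LfunP; split=> //.
by apply: le_lt_trans voo; exact: Lnorm_le_mono.
Qed.

Lemma Lfun_ae s u v : measurable_fun setT u -> v \in Lfun leb3 s%:E ->
  {ae leb3, forall x, u x = v x} -> u \in Lfun leb3 s%:E.
Proof.
by move=> mu /mem_LfunP[mv voo] uv; apply/mem_LfunP; split => //; rewrite (Lnorm_ae _ mu mv uv).
Qed.

Lemma norm_LD s u v : 1 <= s -> u \in Lfun leb3 s%:E -> v \in Lfun leb3 s%:E ->
  (u \+ v) \in Lfun leb3 s%:E /\ norm_L s (u \+ v) <= norm_L s u + norm_L s v.
Proof.
move=> s1 Lu Lv; have [mu uoo] := (mem_LfunP _ _ _).1 Lu; have [mv voo] := (mem_LfunP _ _ _).1 Lv.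
have h := minkowski_EFin leb3 mu mv s1.
have Luv : (u \+ v) \in Lfun leb3 s%:E.
  apply/mem_LfunP; split; first exact: measurable_funD.
  by apply: le_lt_trans h _; rewrite lte_add_pinfty.
by split=> //; rewrite -lee_fin EFinD !norm_LE.
Qed.

Lemma norm_L_le s u v : 0 < s -> measurable_fun setT u -> v \in Lfun leb3 s%:E ->
  (forall x, `|u x| <= `|v x|) -> norm_L s u <= norm_L s v.
Proof.
move=> s0 mu Lv uv; have Lu := Lfun_le s0 mu Lv uv.
rewrite -lee_fin !norm_LE//; apply: Lnorm_le_mono => //.
by have /mem_LfunP[] := Lv.
Qed.

(** Split the difference as A_n (g(k_n x) - g(k x)) + (A_n - A) g(k x): dilation continuity handles
    the first part, convergence of amplitudes the second. *)
Lemma cvg_norm_L_dilation p g (A_ k_ : nat -> R) A k kappa : 1 <= p ->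
  g \in Lfun leb3 p%:E -> 0 < kappa -> (forall n, kappa <= k_ n) -> kappa <= k ->
  A_ n @[n --> \oo] --> A -> k_ n @[n --> \oo] --> k ->
  norm_L p ((fun x => A_ n * g (k_ n *: x)) \- (fun x => A * g (k *: x))) @[n --> \oo] --> 0.
Proof.
move=> p1 Lg kappa0 k_kappa kkappa hA hk.
have p0 : 0 < p by exact: lt_le_trans p1.
have [mg gcont] := Lfun_dilation_continuous p1 Lg.
have {}gcont := gcont k_ k kappa kappa0 k_kappa kkappa hk.
have k_0 n : 0 < k_ n by exact: lt_le_trans (k_kappa n).
have k0 : 0 < k by exact: lt_le_trans kkappa.
pose D n := (fun x => g (k_ n *: x)) \- (fun x => g (k *: x)).
have LD n : D n \in Lfun leb3 p%:E.
  apply: Lfun_sub => //.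
    rewrite (_ : (fun x => _) = (fun x => 1 * g (k_ n *: x))); first exact: Lfun_scaled.
    by apply/funext => x; rewrite mul1r.
  rewrite (_ : (fun x => _) = (fun x => 1 * g (k *: x))); first exact: Lfun_scaled.
  by apply/funext => x; rewrite mul1r.
have Lk : (fun x => g (k *: x)) \in Lfun leb3 p%:E.
  rewrite (_ : (fun x => _) = (fun x => 1 * g (k *: x))); first exact: Lfun_scaled.
  by apply/funext => x; rewrite mul1r.
have D0 : norm_L p (D n) @[n --> \oo] --> 0 by case/fine_cvgP : gcont.
apply: (@squeeze_cvgr _ _ _ _ (cst 0) (fun n => `|A_ n| * norm_L p (D n) +
   `|A_ n - A| * norm_L p (fun x => g (k *: x)))).
- apply: nearW => n; rewrite norm_L_ge0/=.
  have ZE (z : R) f : f \in Lfun leb3 p%:E ->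
      (fun x => z * f x) \in Lfun leb3 p%:E /\ norm_L p (fun x => z * f x) = `|z| * norm_L p f.
    move=> Lf; have [mf foo] := (mem_LfunP _ _ _).1 Lf.
    have Lz : (fun x => z * f x) \in Lfun leb3 p%:E.
      apply/mem_LfunP; split; first exact: measurable_funM.
      by rewrite LnormMl// lte_mul_pinfty ?lee_fin.
    by split => //; apply: EFin_inj; rewrite EFinM !norm_LE// LnormMl.
  have [L1 <-] := ZE (A_ n) _ (LD n); have [L2 <-] := ZE (A_ n - A) _ Lk.
  have [_] := norm_LD p1 L1 L2; apply: le_trans.
  rewrite le_eqVlt; apply/orP; left; apply/eqP; congr (norm_L _ _).
  by apply/funext => x; rewrite /D /=; ring.
- exact: cvg_cst.
- have H1 : `|A_ n| * norm_L p (D n) @[n --> \oo] --> `|A| * 0.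
    by apply: cvgM => //; exact: cvg_norm.
  have H0 : A_ n - A @[n --> \oo] --> 0.
    by rewrite -(subrr A); apply: cvgB => //; exact: cvg_cst.
  have H2 : `|A_ n - A| * norm_L p (fun x => g (k *: x)) @[n --> \oo] -->
      `|0 : R| * norm_L p (fun x => g (k *: x)).
    by apply: cvgMr_tmp; exact: cvg_norm.
  by rewrite -[X in _ --> X](_ : `|A| * 0 + `|0 : R| * norm_L p (fun x => g (k *: x)) = 0);
    [exact: cvgD|rewrite mulr0 normr0 mul0r addr0].
Qed.

End norm_L.

(** * Gradient norms: Lipschitz dependence and behaviour under dilations *)

Section gradients.
Context {R : realType}.
Variables (p : R) (p1 : 1 <= p).
Implicit Types (u v : R3 R -> R) (g h : 'I_3 -> R3 R -> R).

Let p0 : 0 < p. Proof. exact: lt_le_trans p1. Qed.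

(** [grad_abs u] is the case of the chosen weak derivatives; an arbitrary family lets explicit
    representatives replace them up to null sets. *)
Definition euclid g : R3 R -> R := fun x => Num.sqrt (\sum_(i < 3) g i x ^+ 2).

Lemma euclid_ge0 g x : 0 <= euclid g x. Proof. exact: sqrtr_ge0. Qed.

Lemma measurable_euclid g : (forall i, measurable_fun setT (g i)) ->
  measurable_fun setT (euclid g).
Proof.
move=> mg; apply: (@measurableT_comp _ _ _ _ _ _ (Num.sqrt : R -> R) _
  (fun x => \sum_(i < 3) g i x ^+ 2)).
  by apply: continuous_measurable_fun; exact: sqrt_continuous.
by apply: measurable_sum => i; exact: measurable_funX.
Qed.

Lemma euclid_le g x : euclid g x <= \sum_(i < 3) `|g i x|.
Proof.
have S0 : 0 <= \sum_(i < 3) `|g i x| by exact: sumr_ge0.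
rewrite -(ger0_norm S0) -sqrtr_sqr ler_sqrt ?sqr_ge0//.
rewrite !big_ord_recl !big_ord0 !addr0 -[X in X + _]real_normK ?num_real//.
rewrite -[X in _ + (X + _)]real_normK ?num_real// -[X in _ + (_ + X)]real_normK ?num_real//.
move: (normr_ge0 (g ord0 x)) (normr_ge0 (g (lift ord0 ord0) x))
  (normr_ge0 (g (lift ord0 (lift ord0 ord0)) x)).
move: `|_| `|_| `|_| => r s t r0 s0 t0.
have : 0 <= r * s by exact: mulr_ge0.
have : 0 <= r * t by exact: mulr_ge0.
have : 0 <= s * t by exact: mulr_ge0.
by nra.
Qed.

Lemma euclid_triangle g h x :
  euclid g x <= euclid h x + euclid (fun i => g i \- h i) x.
Proof.
have rhs0 : 0 <= euclid h x + euclid (fun i => g i \- h i) x.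
  by rewrite addr_ge0// euclid_ge0.
rewrite -(ger0_norm rhs0) -sqrtr_sqr ler_sqrt ?sqr_ge0// sqrrD.
have sq k : euclid k x ^+ 2 = \sum_(i < 3) k i x ^+ 2.
  by rewrite sqr_sqrtr// sumr_ge0// => i _; exact: sqr_ge0.
have CS : \sum_(i < 3) h i x * (g i x - h i x) <=
    euclid h x * euclid (fun i => g i \- h i) x.
  rewrite -sqrtrM; last by rewrite sumr_ge0// => i _; exact: sqr_ge0.
  apply: le_trans (ler_norm _) _; rewrite -sqrtr_sqr ler_sqrt; last first.
    by rewrite mulr_ge0// sumr_ge0// => i _; exact: sqr_ge0.
  rewrite !big_ord_recl !big_ord0 !addr0 /=.
  move: (h _ x) (h _ x) (h _ x) (g _ x) (g _ x) (g _ x) => a b c a' b' c'.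
  (* Lagrange's identity: the defect in Cauchy-Schwarz is the sum of the squares of the three 2 by 2
     minors. *)
  have := sqr_ge0 (a * (b' - b) - b * (a' - a)).
  have := sqr_ge0 (a * (c' - c) - c * (a' - a)).
  have := sqr_ge0 (c * (b' - b) - b * (c' - c)).
  by move=> h1 h2 h3; rewrite -subr_ge0;
    apply: (le_trans (addr_ge0 (addr_ge0 h1 h2) h3));
    rewrite le_eqVlt; apply/orP; left; apply/eqP; ring.
rewrite !sq; move: CS; rewrite !big_ord_recl !big_ord0 !addr0 /=.
move: (euclid h x * _) => P; move: (h _ x) (h _ x) (h _ x) (g _ x) (g _ x) (g _ x) => a b c a' b' c'.
by rewrite -mulr_natl => CS; lra.
Qed.

Lemma Lfun_euclid g : (forall i, g i \in Lfun leb3 p%:E) ->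
  euclid g \in Lfun leb3 p%:E /\
  norm_L p (euclid g) <= \sum_(i < 3) norm_L p (g i).
Proof.
move=> Lg; have mg i : measurable_fun setT (g i) by have /mem_LfunP[] := Lg i.
pose a i (x : R3 R) := `|g i x|.
have La i : a i \in Lfun leb3 p%:E.
  by apply: (Lfun_le p0 _ (Lg i)) => [|x]; [exact: measurableT_comp|rewrite normr_id].
have aE i : norm_L p (a i) = norm_L p (g i).
  rewrite /norm_L; congr fine; rewrite -[RHS]Lnorm_abse; apply: eq_Lnorm => x.
  by rewrite /a.
pose i1 : 'I_3 := lift ord0 ord0; pose i2 : 'I_3 := lift ord0 (lift ord0 ord0).
have [L12 h12] := norm_LD p1 (La i1) (La i2).
have [L h] := norm_LD p1 (La ord0) L12.
have gle x : `|euclid g x| <= `|(a ord0 \+ (a i1 \+ a i2)) x|.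
  rewrite ger0_norm ?euclid_ge0// ger0_norm ?addr_ge0 ?normr_ge0//.
  by have := euclid_le g x; rewrite !big_ord_recl big_ord0 addr0.
have mE := measurable_euclid mg.
split; first exact: Lfun_le L gle.
apply: le_trans (norm_L_le p0 mE L gle) _; apply: le_trans h _.
by rewrite !big_ord_recl big_ord0 addr0 !aE lerD2l -!aE.
Qed.

Lemma W1p_measurable u : W1p p u -> measurable_fun setT u.
Proof. by move=> [/mem_LfunP[]]. Qed.

Lemma W1p_weak_partial u i : W1p p u -> is_weak_partial i u (weak_partial i u).
Proof. by move=> [_ /(_ i) [g ug _]]; apply: weak_partialP; exists g. Qed.

Lemma Lfun_weak_partial u i : W1p p u -> weak_partial i u \in Lfun leb3 p%:E.
Proof.
move=> [_ /(_ i) [g ug Lg]].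
by apply: (Lfun_ae _ Lg); [exact: measurable_weak_partial|exact: weak_partialE].
Qed.

Lemma Lfun_grad_abs u : W1p p u -> grad_abs u \in Lfun leb3 p%:E.
Proof. by move=> Wu; apply: (Lfun_euclid _).1 => i; exact: Lfun_weak_partial. Qed.

Lemma grad_absE u g : (forall i, is_weak_partial i u (g i)) ->
  {ae leb3, forall x, grad_abs u x = euclid g x}.
Proof.
move=> ug.
(* Indexing the components by natural numbers makes this a countable intersection of full sets; from
   3 on the condition is void. *)
have : {ae leb3, forall x (n : nat), forall i : 'I_3, i = n :> nat -> weak_partial i u x = g i x}.
  apply: ae_foralln => n; have [n3|n3] := ltnP n 3; last first.
    by apply: aeW => x i iE; move: (ltn_ord i); rewrite iE ltnNge n3.
  have := weak_partialE (ug (Ordinal n3)); apply: filterS => x h i iE.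
  by rewrite (_ : i = Ordinal n3)//; exact: val_inj.
apply: filterS => x h; rewrite /grad_abs /euclid; congr Num.sqrt.
by apply: eq_bigr => i _; rewrite (h i).
Qed.

Lemma norm_grad_sub u v : W1p p u -> W1p p v ->
  norm_L p (grad_abs u) <= norm_L p (grad_abs v) + norm_L p (grad_abs (u \- v)).
Proof.
move=> Wu Wv.
pose g i := weak_partial i u \- weak_partial i v.
have Lg i : g i \in Lfun leb3 p%:E by apply: Lfun_sub => //; exact: Lfun_weak_partial.
have [Le _] := Lfun_euclid Lg.
have me : measurable_fun setT (euclid g) by have /mem_LfunP[] := Le.
have -> : norm_L p (grad_abs (u \- v)) = norm_L p (euclid g).
  apply: norm_L_ae => //; first exact: measurable_grad_abs.
  by apply: grad_absE => i; apply: is_weak_partialB; exact: W1p_weak_partial.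
have [Ls hs] := norm_LD p1 (Lfun_grad_abs Wv) Le.
apply: le_trans hs; apply: norm_L_le => //; first exact: measurable_grad_abs.
move=> x; rewrite ger0_norm ?sqrtr_ge0// ger0_norm ?addr_ge0 ?sqrtr_ge0//.
exact: euclid_triangle.
Qed.

Lemma ler_dist_of_le (x y z t w : R) : x <= y + z -> y <= x + t -> t = z -> 0 <= w ->
  `|x - y| <= w + z.
Proof. by move=> xy yx tz w0; rewrite ler_norml; apply/andP; split; lra. Qed.

Lemma norm_grad_lipschitz u v : W1p p u -> W1p p v ->
  `|norm_L p (grad_abs u) - norm_L p (grad_abs v)| <= W1p_dist p u v.
Proof.
move=> Wu Wv.
have h1 := norm_grad_sub Wu Wv; have h2 := norm_grad_sub Wv Wu.
(* The representatives chosen for [u \- v] and [v \- u] need not be opposite pointwise, so symmetry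
   is read off the differences of those of [u] and [v]. *)
have E : norm_L p (grad_abs (v \- u)) = norm_L p (grad_abs (u \- v)).
  pose g i := weak_partial i u \- weak_partial i v.
  pose h i := weak_partial i v \- weak_partial i u.
  have mw := fun w i => @measurable_weak_partial R i w.
  transitivity (norm_L p (euclid h)).
    apply: norm_L_ae; [exact: measurable_grad_abs|by apply: measurable_euclid => i; exact: measurable_funB|].
    by apply: grad_absE => i; apply: is_weak_partialB; exact: W1p_weak_partial.
  transitivity (norm_L p (euclid g)); last first.
    apply/esym/norm_L_ae; [exact: measurable_grad_abs|by apply: measurable_euclid => i; exact: measurable_funB|].
    by apply: grad_absE => i; apply: is_weak_partialB; exact: W1p_weak_partial.
  congr norm_L; apply/funext => x; congr Num.sqrt; apply: eq_bigr => i _.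
  by rewrite /h /g /= -sqrrN opprB.
exact: ler_dist_of_le h1 h2 E (norm_L_ge0 p (u \- v)).
Qed.

Lemma is_weak_partial_scaled u A k i : 0 < A -> 0 < k -> W1p p u ->
  is_weak_partial i (fun x => A * u (k *: x)) (fun x => A * k * weak_partial i u (k *: x)).
Proof. by move=> A0 k0 Wu; apply: is_weak_partial_scale => //; exact: W1p_weak_partial. Qed.

Lemma W1p_scaled u A k : 0 < A -> 0 < k -> W1p p u -> W1p p (fun x => A * u (k *: x)).
Proof.
move=> A0 k0 Wu; split; first by apply: Lfun_scaled => //; case: Wu.
move=> i; exists (fun x => A * k * weak_partial i u (k *: x)).
  exact: is_weak_partial_scaled.
by apply: Lfun_scaled => //; exact: Lfun_weak_partial.
Qed.

Lemma grad_abs_scaled u A k : 0 < A -> 0 < k -> W1p p u ->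
  {ae leb3, forall x, grad_abs (fun x => A * u (k *: x)) x = A * k * grad_abs u (k *: x)}.
Proof.
move=> A0 k0 Wu.
have := grad_absE (fun i => is_weak_partial_scaled i A0 k0 Wu).
apply: filterS => x ->; rewrite /euclid /grad_abs.
under eq_bigr do rewrite exprMn.
by rewrite -mulr_sumr sqrtrM ?sqr_ge0// sqrtr_sqr gtr0_norm// mulr_gt0.
Qed.

Lemma norm_grad_scaled u A k : 0 < A -> 0 < k -> W1p p u ->
  norm_L p (grad_abs (fun x => A * u (k *: x))) =
  A * k * (k `^ (- (3 / p)) * norm_L p (grad_abs u)).
Proof.
move=> A0 k0 Wu; have mg := measurable_grad_abs u.
rewrite -norm_L_scale ?mulr_gt0//; apply: norm_L_ae.
- exact: measurable_grad_abs.
- by apply: measurable_funM => //; exact: measurable_scaled.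
- exact: grad_abs_scaled.
Qed.

Lemma cvg0_sum3 (F : 'I_3 -> nat -> R) : (forall i, F i n @[n --> \oo] --> 0) ->
  \sum_(i < 3) F i n @[n --> \oo] --> 0.
Proof.
move=> F0; rewrite (_ : (fun n => _) = (fun n => F ord0 n +
  (F (lift ord0 ord0) n + F (lift ord0 (lift ord0 ord0)) n))).
  rewrite -[X in _ --> X](addr0 0); apply: cvgD; first exact: F0.
  by rewrite -[X in _ --> X](addr0 0); apply: cvgD; exact: F0.
by apply/funext => n; rewrite !big_ord_recl big_ord0 addr0.
Qed.

(** The weak derivatives of a dilate are dilates of the weak derivatives with amplitude A k, so
    everything reduces to continuity in L^p of four functions. *)
Lemma cvg_W1p_dilation u (A_ k_ : nat -> R) (A k kappa : R) : W1p p u ->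
  (forall n, 0 < A_ n) -> 0 < A ->
  0 < kappa -> (forall n, kappa <= k_ n) -> kappa <= k ->
  A_ n @[n --> \oo] --> A -> k_ n @[n --> \oo] --> k ->
  W1p_dist p (fun x => A_ n * u (k_ n *: x)) (fun x => A * u (k *: x)) @[n --> \oo] --> 0.
Proof.
move=> Wu A_0 A0 kappa0 k_kappa kkappa hA hk.
have k_0 n : 0 < k_ n by exact: lt_le_trans (k_kappa n).
have k0 : 0 < k by exact: lt_le_trans kkappa.
have Lu : u \in Lfun leb3 p%:E by case: Wu.
pose D n i := (fun x => A_ n * k_ n * weak_partial i u (k_ n *: x)) \-
              (fun x => A * k * weak_partial i u (k *: x)).
have LD n i : D n i \in Lfun leb3 p%:E.
  by apply: Lfun_sub => //; apply: Lfun_scaled => //; exact: Lfun_weak_partial.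
have gradle n : norm_L p (grad_abs ((fun x => A_ n * u (k_ n *: x)) \- (fun x => A * u (k *: x)))) <=
    \sum_(i < 3) norm_L p (D n i).
  have [Le] := Lfun_euclid (LD n); apply: le_trans.
  rewrite le_eqVlt; apply/orP; left; apply/eqP; apply: norm_L_ae.
  - exact: measurable_grad_abs.
  - by have /mem_LfunP[] := Le.
  - by apply: grad_absE => i; apply: is_weak_partialB; exact: is_weak_partial_scaled.
have cD i : norm_L p (D n i) @[n --> \oo] --> 0.
  by apply: (cvg_norm_L_dilation (A_ := fun n => A_ n * k_ n) p1 _ kappa0) => //;
    [exact: Lfun_weak_partial|exact: cvgM].
have c0 : norm_L p ((fun x => A_ n * u (k_ n *: x)) \- (fun x => A * u (k *: x))) @[n --> \oo] --> 0.
  exact: (cvg_norm_L_dilation p1 Lu kappa0).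
apply: (@squeeze_cvgr _ _ _ _ (cst 0) (fun n => norm_L p ((fun x => A_ n * u (k_ n *: x)) \- (fun x => A * u (k *: x))) +
   \sum_(i < 3) norm_L p (D n i))).
- by apply: nearW => n; rewrite /W1p_dist addr_ge0 ?norm_L_ge0//= lerD2l.
- exact: cvg_cst.
- rewrite -[X in _ --> X](addr0 0); apply: cvgD; first exact: c0.
  exact: (cvg0_sum3 (F := fun i n => norm_L p (D n i))).
Qed.

End gradients.

(** * Rescaling of the weak forms *)

Section forms.
Context {R : realType}.
Implicit Types (u v phi : R3 R -> R) (A k s : R).

Lemma powRB2M A s : 0 < A -> A `^ (s - 2) * A = A `^ (s - 1).
Proof.
move=> A0; rewrite -[X in _ * X](powRr1 (ltW A0)) -powRD; last by rewrite (gt_eqF A0) implybT.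
by congr (_ `^ _); ring.
Qed.

Lemma unscaleE k phi (x : R3 R) : 0 < k -> phi x = phi (k^-1 *: (k *: x)).
Proof. by move=> k0; rewrite scalerA mulVf ?scale1r// gt_eqF. Qed.

Lemma power_form_scaled s A k u phi : 0 < A -> 0 < k -> measurable_fun setT u ->
  test_function phi ->
  power_form s (fun x : R3 R => A * u (k *: x)) phi =
  A `^ (s - 1) * k ^- 3 * power_form s u (fun x : R3 R => phi (k^-1 *: x)).
Proof.
move=> A0 k0 mu tphi.
have kV0 : 0 < k^-1 by rewrite invr_gt0.
have tpsi := test_function_scale kV0 tphi.
have mpsi : measurable_fun setT (fun x : R3 R => phi (k^-1 *: x)).
  by apply: continuous_measurable_R3; exact: test_function_continuous.
pose F (x : R3 R) := `|u x| `^ (s - 2) * u x * phi (k^-1 *: x).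
have mF : measurable_fun setT F.
  apply: measurable_funM => //; apply: measurable_funM => //.
  apply: (@measurableT_comp _ _ _ _ _ _ (fun r : R => r `^ (s - 2))) => //.
  exact: measurableT_comp.
rewrite /power_form -mulrA -(Rintegral_scale k0 mF) -gt0_RintegralZl ?powR_gt0//; last first.
  exact: measurable_scaled.
apply: eq_Rintegral => x _; rewrite /F (unscaleE phi x k0).
by rewrite normrM powRM// (gtr0_norm A0) -(powRB2M _ A0); ring.
Qed.

Lemma partial_unscale k phi i x : 0 < k -> test_function phi ->
  partial i phi x = k * partial i (fun y : R3 R => phi (k^-1 *: y)) (k *: x).
Proof.
move=> k0 tphi; have kV0 : 0 < k^-1 by rewrite invr_gt0.
have dphi y : derivable phi y (basis3 i) by have [/(_ 1%N)/= [_ /(_ i) []]] := tphi.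
have [_ /(congr1 (fun f => f (k *: x)))] := partial_scale 1 kV0 dphi.
rewrite mul1r -unscaleE//.
rewrite (_ : (fun y => 1 * phi (k^-1 *: y)) = (fun y : R3 R => phi (k^-1 *: y))); last first.
  by apply/funext => y; rewrite mul1r.
by move=> ->; rewrite mulrA divff ?mul1r// gt_eqF.
Qed.

Variables (p : R) (p1 : 1 <= p).

(** The factor (A k)^(p-1) is homogeneity in the gradient, k comes from differentiating the dilated
    test function, and k^-3 from the change of variables. *)
Lemma plaplace_form_scaled A k u phi : 0 < A -> 0 < k -> W1p p u ->
  test_function phi ->
  plaplace_form p (fun x : R3 R => A * u (k *: x)) phi =
  (A * k) `^ (p - 1) * k * k ^- 3 * plaplace_form p u (fun x : R3 R => phi (k^-1 *: x)).
Proof.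
move=> A0 k0 Wu tphi; have Ak0 : 0 < A * k by exact: mulr_gt0.
have kV0 : 0 < k^-1 by rewrite invr_gt0.
have tpsi := test_function_scale kV0 tphi.
pose psi (x : R3 R) := phi (k^-1 *: x).
have mp (f : R3 R -> R) i : test_function f -> measurable_fun setT (partial i f).
  by move=> tf; apply: continuous_measurable_R3; exact: partial_continuous.
have mpow (f : R3 R -> R) : measurable_fun setT f -> measurable_fun setT (fun x => f x `^ (p - 2)).
  by move=> mf; apply: (@measurableT_comp _ _ _ _ _ _ (fun r : R => r `^ (p - 2))).
have mform v f : test_function f -> measurable_fun setT (fun x => grad_abs v x `^ (p - 2)
                * \sum_(i < 3) weak_partial i v x * partial i f x).
  move=> tf; apply: measurable_funM; first by apply: mpow; exact: measurable_grad_abs.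
  apply: measurable_sum => i; apply: measurable_funM; first exact: measurable_weak_partial.
  exact: mp.
pose F (x : R3 R) := grad_abs u x `^ (p - 2) * \sum_(i < 3) weak_partial i u x * partial i psi x.
have mF : measurable_fun setT F by exact: mform.
have mFk := measurable_scaled k mF.
rewrite /plaplace_form -(mulrA (_ * k)) -(Rintegral_scale k0 mF).
rewrite -gt0_RintegralZl ?mulr_gt0 ?powR_gt0//.
rewrite /Rintegral; congr fine; apply: ae_eq_integral => //.
- by apply/measurable_EFinP; exact: mform.
- by apply/measurable_EFinP; exact: measurable_funM.
have hg := grad_abs_scaled A0 k0 Wu.
have hw i := weak_partialE (is_weak_partial_scaled i A0 k0 Wu).
have : {ae leb3, forall x (n : nat) (i : 'I_3), i = n :> nat ->
    weak_partial i (fun x : R3 R => A * u (k *: x)) x = A * k * weak_partial i u (k *: x)}.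
  apply: ae_foralln => n; have [n3|n3] := ltnP n 3; last first.
    by apply: aeW => x i iE; move: (ltn_ord i); rewrite iE ltnNge n3.
  apply: filterS (hw (Ordinal n3)) => x h i iE.
  by rewrite (_ : i = Ordinal n3)//; exact: val_inj.
apply: filterS2 hg => x hgx hwx _; congr EFin; rewrite hgx /F.
have g0 : 0 <= grad_abs u (k *: x) by exact: sqrtr_ge0.
rewrite (powRM (p - 2) (ltW Ak0) g0) -(powRB2M _ Ak0).
under eq_bigr => i _ do rewrite (hwx i i erefl) (partial_unscale i x k0 tphi).
rewrite (_ : \sum_(i < 3) _ = A * k * k * \sum_(i < 3) weak_partial i u (k *: x) * partial i psi (k *: x)).
  by ring.
by rewrite mulr_sumr; apply: eq_bigr => i _; rewrite /psi; ring.
Qed.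

Lemma Rintegral_grad_abs u : \int[leb3]_x (grad_abs u x `^ p) = norm_L p (grad_abs u) `^ p.
Proof.
rewrite norm_L_powR; last exact: lt_le_trans p1.
by apply: eq_Rintegral => x _; rewrite ger0_norm// sqrtr_ge0.
Qed.

End forms.

(** * Matching of exponents and constants *)

Section powers.
Context {R : realType}.
Implicit Types (a b c p q m t : R).

(** Writing each positive quantity as an exponential reduces the identities below to rational
    identities between exponents. *)
Lemma powR_expR (x r : R) : expR x `^ r = expR (x * r).
Proof. by rewrite /powR gt_eqF ?expR_gt0// expRK mulrC. Qed.

Lemma expR_ex (x : R) : 0 < x -> exists y, x = expR y.
Proof. by move=> x0; exists (ln x); rewrite lnK// posrE. Qed.

Definition fiber_coef p q c m : R := c `^ (q - 3 * (q - p) / p) / (p * m `^ (q - p)).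

(** With q/p m^p standing for |Q|_q^q, the left side is |u|_q^q/q for the profile of kinetic energy
    t: the last term of f. *)
Lemma profile_energy_coef p q c m t : 0 < p -> 0 < q -> 0 < c -> 0 < m -> 0 < t ->
  let k := t `^ p^-1 / c in let A := c * k `^ (3 / p) / m in
  q^-1 * (A `^ q * ((k `^ (- (3 / q))) `^ q * (q / p * m `^ p))) =
  fiber_coef p q c m * t `^ (3 * (q - p) / p ^+ 2).
Proof.
move=> p0 q0 /expR_ex[g ->] /expR_ex[n ->] /expR_ex[s ->] /=.
rewrite /fiber_coef !(powR_expR, =^~ expRN, =^~ expRD).
set X := (X in q / p * expR X).
transitivity (p^-1 * expR ((g + (s / p - g) * (3 / p) - n) * q + ((s / p - g) * - (3 / q) * q + n * p))).
  by rewrite !expRD; field; rewrite !gt_eqF.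
transitivity (p^-1 * expR (g * (q - 3 * (q - p) / p) - n * (q - p) + s * (3 * (q - p) / p ^+ 2))).
  by congr (_ * expR _); field; rewrite !gt_eqF.
by rewrite !expRD expRN; field; rewrite !gt_eqF ?expR_gt0.
Qed.

(** The first factor is a + b t when f'(t) = 0, the second is the scaling of the p-Laplacian form.
    On the right, the scaling of the power form meets the coefficient th of the p-Laplacian in the
    equation of [Q]. *)
Lemma profile_pde_coef p q c m t : 0 < p -> 0 < c -> 0 < m -> 0 < t ->
  let k := t `^ p^-1 / c in let A := c * k `^ (3 / p) / m in
  let th := 3 * (q - p) / p ^+ 2 in
  p * (fiber_coef p q c m * th * t `^ (th - 1)) * ((A * k) `^ (p - 1) * k * k ^- 3) =
  A `^ (q - 1) * k ^- 3 * th.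
Proof.
move=> p0 /expR_ex[g ->] /expR_ex[n ->] /expR_ex[s ->] /=.
rewrite /fiber_coef !(powR_expR, =^~ expRN, =^~ expRD).
set th := 3 * (q - p) / p ^+ 2.
transitivity (th * expR (s / p - g) ^- 3 * (expR (g * (q - 3 * (q - p) / p) - n * (q - p)) * expR (s * (th - 1)) *
  (expR ((g + (s / p - g) * (3 / p) - n + (s / p - g)) * (p - 1)) * expR (s / p - g)))).
  rewrite (expRD (_ * (p - 1)) (s / p - g)) (expRD (g * _)) expRN; field.
  by rewrite !gt_eqF ?expR_gt0.
rewrite -!expRD [LHS]mulrC [LHS]mulrA [LHS]mulrAC; congr (expR _ * _ * _).
by rewrite /th; field; rewrite gt_eqF.
Qed.

(** The Gagliardo-Nirenberg bound at mass c, raised to the power q and divided by q, is the last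
    term of f at G^p. *)
Lemma gn_coef p q c m (G : R) : 0 < p -> 0 < q -> 0 < c -> 0 < m -> 0 <= G ->
  q^-1 * ((q / p * (m `^ (q - p))^-1) `^ q^-1 * G `^ (3 * (q - p) / (q * p))
       * c `^ (1 - 3 * (q - p) / (q * p))) `^ q =
  fiber_coef p q c m * (G `^ p) `^ (3 * (q - p) / p ^+ 2).
Proof.
move=> p0 q0 c0 m0 G0.
have mq : 0 < m `^ (q - p) by exact: powR_gt0.
have h0 : 0 <= q / p * (m `^ (q - p))^-1.
  by apply: mulr_ge0; [apply: divr_ge0; exact: ltW|rewrite invr_ge0 ltW].
rewrite (powRM q (mulr_ge0 (powR_ge0 _ _) (powR_ge0 _ _)) (powR_ge0 _ _)).
rewrite (powRM q (powR_ge0 _ _) (powR_ge0 _ _)) -!powRrM mulVf ?gt_eqF// (powRr1 h0).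
rewrite (_ : 3 * (q - p) / (q * p) * q = p * (3 * (q - p) / p ^+ 2)); last first.
  by field; rewrite !gt_eqF.
rewrite (_ : (1 - 3 * (q - p) / (q * p)) * q = q - 3 * (q - p) / p); last first.
  by field; rewrite !gt_eqF.
by rewrite /fiber_coef; field; rewrite !gt_eqF.
Qed.

(** The lower bound on [c] is the inequality b/(2p) < [fiber_coef] solved for c. At the critical [q]
    the exponent of c is (2p^2-3p)/3, positive because p > 3/2. *)
Lemma fiber_case p q b c m : 3 / 2 < p -> 0 < b -> 0 < c -> 0 < m ->
  (p + 2 * p ^+ 2 / 3 < q \/
    (q = p + 2 * p ^+ 2 / 3 /\
     (b * m `^ (2 * p ^+ 2 / 3) / 2) `^ (3 / (2 * p ^+ 2 - 3 * p)) < c)) ->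
  2 < 3 * (q - p) / p ^+ 2 \/ 3 * (q - p) / p ^+ 2 = 2 /\ b / (2 * p) < fiber_coef p q c m.
Proof.
move=> p32 b0 c0 m0; have p0 : 0 < p by lra.
have p20 : 0 < p ^+ 2 by exact: exprn_gt0.
case=> [qgt|[-> hc]]; [left|right].
  by rewrite ltr_pdivlMr//; lra.
split; first by field; rewrite gt_eqF.
have d0 : 0 < 2 * p ^+ 2 - 3 * p by rewrite expr2; nra.
have X0 : 0 < b * m `^ (2 * p ^+ 2 / 3) / 2 by rewrite divr_gt0// mulr_gt0// powR_gt0.
have e0 : 0 < (2 * p ^+ 2 - 3 * p) / 3 by rewrite divr_gt0.
have := gt0_ltr_powR e0 _ _ hc; rewrite !nnegrE powR_ge0 => /(_ isT (ltW c0)).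
rewrite -powRrM (_ : 3 / (2 * p ^+ 2 - 3 * p) * _ = 1); last by field; rewrite gt_eqF.
rewrite powRr1 ?ltW// /fiber_coef => h.
rewrite (_ : p + 2 * p ^+ 2 / 3 - p = 2 * p ^+ 2 / 3); last by ring.
rewrite (_ : p + 2 * p ^+ 2 / 3 - 3 * (2 * p ^+ 2 / 3) / p = (2 * p ^+ 2 - 3 * p) / 3); last first.
  by field; rewrite gt_eqF.
rewrite ltr_pdivlMr ?mulr_gt0 ?powR_gt0//; apply: le_lt_trans h.
by rewrite le_eqVlt; apply/orP; left; apply/eqP; field; rewrite gt_eqF.
Qed.

End powers.

(** On functions of kinetic energy at most K the energy is at most al K + be K^2, so this K
    separates the starts of paths from the level [F]. As K <= t, the quadratic is at most K(al + be
    t) <= F/2. *)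
Lemma small_quadratic (R : realType) (al be t F : R) : 0 < al -> 0 < be -> 0 < t -> 0 < F ->
  exists K, [/\ 0 < K, K <= t & al * K + be * K ^+ 2 < F].
Proof.
move=> al0 be0 t0 F0.
have d0 : 0 < al + be * t by rewrite addr_gt0// mulr_gt0.
exists (Num.min t (F / (2 * (al + be * t)))).
have : Num.min t (F / (2 * (al + be * t))) <= F / (2 * (al + be * t)) by rewrite ge_min lexx orbT.
have : Num.min t (F / (2 * (al + be * t))) <= t by rewrite ge_min lexx.
have : 0 < Num.min t (F / (2 * (al + be * t))) by rewrite lt_min t0 divr_gt0// mulr_gt0.
move: (Num.min _ _) => K K0 Kt; rewrite ler_pdivlMr ?mulr_gt0// => KF; split => //.
have : be * K ^+ 2 <= K * (be * t) by rewrite expr2 mulrCA ler_pM2l// ler_pM2l.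
lra.
Qed.

(** Abstract form of the rescaled equation: X = a + b t; Y, W k3 and Z k3 are the scalings of the
    p-Laplacian, mass and power forms; th P + l M is the power form of [Q] given by its own
    equation. The multiplier is -(Z/W) l. *)
Lemma kirchhoff_identity (R : realType) (X Y Z W k3 th l P M : R) :
  X * Y = Z * k3 * th -> (W == 0) = false ->
  X * (Y * P) = - (Z / W) * l * (W * k3 * M) + Z * k3 * (th * P + l * M).
Proof.
move=> XY W0; rewrite mulrA XY; field; by rewrite W0.
Qed.

(** * The profiles and the mountain pass level *)

Section mountain_pass.
Context {R : realType}.
Variables (a b c p q : R) (Q : R3 R -> R).
Hypotheses (a0 : 0 < a) (b0 : 0 < b) (c0 : 0 < c) (p1 : 1 <= p) (pq : p < q).
Hypotheses (WQ : W1p p Q) (Q0 : nontrivial Q).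
Hypothesis hQ_grad : norm_L p (grad_abs Q) `^ p = norm_L p Q `^ p.
Hypothesis hQ_mass : norm_L p Q `^ p = p / q * norm_L q Q `^ q.
Hypothesis hGN : forall u : R3 R -> R, W1p p u ->
    ('N[leb3]_q%:E[EFin \o u] <=
      ((q / p * (norm_L p Q `^ (q - p))^-1) `^ q^-1
       * norm_L p (grad_abs u) `^ (3 * (q - p) / (q * p))
       * norm_L p u `^ (1 - 3 * (q - p) / (q * p)))%:E)%E.

Let p0 : 0 < p. Proof. exact: lt_le_trans p1. Qed.
Let q0 : 0 < q. Proof. exact: lt_trans pq. Qed.
Let m := norm_L p Q.

Local Notation f := (fiber_map a b p q c m).
Local Notation profile t := (scaled_profile p c m (t `^ p^-1 / c) Q).
Local Notation kin u := (norm_L p (grad_abs u) `^ p).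

Lemma ground_norm_gt0 : 0 < m.
Proof.
rewrite lt_neqAle norm_L_ge0 andbT eq_sym; apply/negP => /eqP m0; apply: Q0.
have [LQ _] := WQ.
have N0 : 'N[leb3]_p%:E[EFin \o Q]%E = 0%E by rewrite -norm_LE// -/m m0.
have mQ : measurable_fun setT (EFin \o Q) by apply/measurable_EFinP; exact: W1p_measurable WQ.
have := Lnorm_eq0_eq0 mQ _ N0; rewrite lte_fin => /(_ p0).
by apply: filterS => x h; apply: EFin_inj; exact: (h I).
Qed.

Let m0 := ground_norm_gt0.

Lemma ground_grad_norm : norm_L p (grad_abs Q) = m.
Proof. by apply: (powR_injective p0) => //; rewrite nnegrE norm_L_ge0. Qed.

Lemma profile_scale_gt0 t : 0 < t -> 0 < t `^ p^-1 / c.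
Proof. by move=> t0; rewrite divr_gt0// powR_gt0. Qed.

Lemma profile_amplitude_gt0 k : 0 < k -> 0 < c * k `^ (3 / p) / m.
Proof. by move=> k0; rewrite divr_gt0// mulr_gt0// powR_gt0. Qed.

Lemma W1p_profile t : 0 < t -> W1p p (profile t).
Proof.
move=> t0; have k0 := profile_scale_gt0 t0.
exact: (W1p_scaled p1 (profile_amplitude_gt0 k0) k0 WQ).
Qed.

Lemma norm_profile t : 0 < t -> norm_L p (profile t) = c.
Proof.
move=> t0; have k0 := profile_scale_gt0 t0.
have kp0 : 0 < (t `^ p^-1 / c) `^ (3 / p) by exact: powR_gt0.
rewrite /scaled_profile norm_L_scale//; last 2 first.
- exact: profile_amplitude_gt0.
- exact: W1p_measurable WQ.
by rewrite powRN -/m; field; rewrite !gt_eqF.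
Qed.

Lemma profile_mass_sphere t : 0 < t -> mass_sphere p c (profile t).
Proof. by move=> t0; split; [exact: W1p_profile|exact: norm_profile]. Qed.

Lemma kin_profile t : 0 < t -> kin (profile t) = t.
Proof.
move=> t0; have k0 := profile_scale_gt0 t0.
have kp0 : 0 < (t `^ p^-1 / c) `^ (3 / p) by exact: powR_gt0.
rewrite /scaled_profile (norm_grad_scaled p1 (profile_amplitude_gt0 k0) k0 WQ) ground_grad_norm.
rewrite (_ : c * (t `^ p^-1 / c) `^ (3 / p) / m * (t `^ p^-1 / c) * _ = t `^ p^-1).
  by rewrite -powRrM mulVf ?gt_eqF// powRr1// ltW.
by rewrite powRN; field; rewrite !gt_eqF.
Qed.

Lemma energyE u : energy a b p q u =
  a / p * kin u + b / (2 * p) * kin u ^+ 2 - q^-1 * norm_L q u `^ q.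
Proof.
rewrite /energy; congr (_ + _ * _ - _).
by rewrite mulrC powRrM powR_mulrn// powR_ge0.
Qed.

Lemma energy_profile t : 0 < t -> energy a b p q (profile t) = f t.
Proof.
move=> t0; have k0 := profile_scale_gt0 t0.
rewrite energyE kin_profile// /fiber_map; congr (_ - _).
rewrite -[RHS](profile_energy_coef p0 q0 c0 m0 t0)/=; congr (_ * _).
have A0 := profile_amplitude_gt0 k0.
rewrite /scaled_profile norm_L_scale//; last exact: W1p_measurable WQ.
rewrite (powRM q (ltW A0) (mulr_ge0 (powR_ge0 _ _) (norm_L_ge0 _ _))).
rewrite (powRM q (powR_ge0 _ _) (norm_L_ge0 _ _)).
congr (_ * (_ * _)); rewrite hQ_mass mulrA.
by rewrite (_ : q / p * (p / q) = 1) ?mul1r//; field; rewrite !gt_eqF.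
Qed.

Lemma energy_ge_fiber u : mass_sphere p c u -> f (kin u) <= energy a b p q u.
Proof.
move=> [Wu uc]; rewrite energyE /fiber_map lerD2l lerN2.
have := hGN Wu; rewrite uc => GN.
(* Being stated in the extended reals, the inequality also yields finiteness of the L^q norm, so
   [norm_L] is the true norm here. *)
have uoo : ('N[leb3]_q%:E[EFin \o u] < +oo)%E by apply: le_lt_trans GN _; rewrite ltry.
have : norm_L q u <= (q / p * (m `^ (q - p))^-1) `^ q^-1
       * norm_L p (grad_abs u) `^ (3 * (q - p) / (q * p)) * c `^ (1 - 3 * (q - p) / (q * p)).
  by rewrite -lee_fin /norm_L fineK// ge0_fin_numE// Lnorm_ge0.
move=> h; rewrite -[leRHS](gn_coef p0 q0 c0 m0 (norm_L_ge0 _ _)).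
rewrite ler_pM2l ?invr_gt0//; apply: ge0_ler_powR => //; rewrite ?nnegrE ?norm_L_ge0 ?(ltW q0)//.
by rewrite !mulr_ge0 ?powR_ge0.
Qed.

Lemma energy_le_kin u : energy a b p q u <= a / p * kin u + b / (2 * p) * kin u ^+ 2.
Proof.
by rewrite energyE lerBlDr lerDl mulr_ge0 ?powR_ge0// invr_ge0 ltW.
Qed.

Lemma continuous_norm_grad h : sphere_path p c h ->
  {within `[0, 1], continuous (fun s => norm_L p (grad_abs (h s)))}.
Proof.
move=> [hS hc]; apply/subspace_continuousP => t t01.
apply/cvgrPdist_le => e e0; have /cvgrPdist_le/(_ e e0) := hc t t01.
apply: filterS2 (withinT _ _) => s s01 hs.
have [Ws _] := hS s s01; have [Wt _] := hS t t01.
rewrite distrC; apply: le_trans (norm_grad_lipschitz p1 Ws Wt) _.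
by apply: le_trans hs; rewrite sub0r normrN ler_norm.
Qed.

Lemma profile_kirchhoff t : 0 < t ->
  a / p + 2 * (b / (2 * p)) * t = fiber_coef p q c m * (3 * (q - p) / p ^+ 2) *
    t `^ (3 * (q - p) / p ^+ 2 - 1) ->
  limit_solution p q Q -> exists lam : R, kirchhoff_solution a b p q c lam (profile t).
Proof.
move=> t_gt0 crit [_ Qsol]; have k0 := profile_scale_gt0 t_gt0.
have A0 := profile_amplitude_gt0 k0.
have mQ := W1p_measurable WQ.
have coef := profile_pde_coef q p0 c0 m0 t_gt0.
have abt : a + b * t = p * (fiber_coef p q c m * (3 * (q - p) / p ^+ 2) *
    t `^ (3 * (q - p) / p ^+ 2 - 1)).
  by rewrite -crit; field; rewrite gt_eqF.
have Ap0 : 0 < (c * (t `^ p^-1 / c) `^ (3 / p) / m) `^ (p - 1) by exact: powR_gt0.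
(* The mass coefficient of the equation of [Q] changes sides and is multiplied by the ratio
   A^(q-1)/A^(p-1) of the scalings of the two power forms. *)
exists (- ((c * (t `^ p^-1 / c) `^ (3 / p) / m) `^ (q - 1) /
  (c * (t `^ p^-1 / c) `^ (3 / p) / m) `^ (p - 1)) * (1 + (p - 3) * (q - p) / p ^+ 2)).
split; [exact: W1p_profile|exact: norm_profile|].
move=> phi tphi.
have kV0 : 0 < (t `^ p^-1 / c)^-1 by rewrite invr_gt0.
have := Qsol _ (test_function_scale kV0 tphi).
rewrite (Rintegral_grad_abs p1) kin_profile// abt /scaled_profile.
rewrite (plaplace_form_scaled A0 k0 WQ tphi) !(power_form_scaled _ A0 k0 mQ tphi) => <-.
exact: kirchhoff_identity coef (gt_eqF Ap0).
Qed.

Variable t0 : R.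
Hypothesis t00 : 0 < t0.
Hypothesis t0_max : forall s, 0 < s -> s != t0 -> f s < f t0.
Hypothesis t0_ge0 : forall s, 0 <= s <= t0 -> 0 <= f s.

Lemma fiber_le_max s : 0 < s -> f s <= f t0.
Proof. by move=> s0; have [->//|/t0_max] := eqVneq s t0; move=> /(_ s0)/ltW. Qed.

(* Every admissible path crosses the sphere |grad u|_p^p = t0. *)
Lemma path_crossing K h : K <= t0 -> mp_paths a b p q c K h ->
  exists2 s, s \in `[0, 1] & f t0 <= energy a b p q (h s).
Proof.
move=> Kt0 [hh [hS0 h0K] h1].
have [hS _] := hh.
have hS1 : mass_sphere p c (h 1) by apply: hS; rewrite in_itv/= ler01 lexx.
pose G s := norm_L p (grad_abs (h s)).
have G0 s : 0 <= G s by exact: norm_L_ge0.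
have r0 : 0 < t0 `^ p^-1 by exact: powR_gt0.
have GE s : (G s `^ p) `^ p^-1 = G s by rewrite -powRrM mulfV ?gt_eqF// powRr1.
have pV0 : 0 <= p^-1 by rewrite invr_ge0 ltW.
have lo : G 0 <= t0 `^ p^-1.
  by rewrite -GE; apply: ge0_ler_powR; rewrite ?nnegrE ?powR_ge0 ?(ltW t00)//;
    exact: le_trans h0K Kt0.
(* Otherwise the endpoint has kinetic energy in [0, t0], where f >= 0 bounds its energy from below,
   against I(h(1)) < 0. *)
have hi : t0 `^ p^-1 <= G 1.
  rewrite -GE; apply: ge0_ler_powR; rewrite ?nnegrE ?powR_ge0 ?(ltW t00)//.
  rewrite leNgt; apply/negP => /ltW lt0.
  have := energy_ge_fiber hS1; rewrite leNgt => /negP; apply.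
  by apply: lt_le_trans h1 _; apply: t0_ge0; rewrite powR_ge0.
have [|s s01 Gs] := IVT ler01 (continuous_norm_grad hh) (v := t0 `^ p^-1).
  by rewrite ge_min lo/= le_max hi orbT.
exists s => //; have := energy_ge_fiber (hS s s01).
by rewrite Gs -powRrM mulVf ?gt_eqF// powRr1// ltW.
Qed.

Lemma mp_level_ge K : K <= t0 -> ((f t0)%:E <= mp_level a b p q c K)%E.
Proof.
move=> Kt0; apply: le_ereal_inf_tmp => _ [h hK <-].
have [s s01 fs] := path_crossing Kt0 hK.
apply: (@le_trans _ _ (energy a b p q (h s))%:E); first by rewrite lee_fin.
by apply: ereal_sup_ubound; exists s.
Qed.

(** The kinetic energy moves affinely from s0 to s1. The absolute value keeps it at least s0 for
    every real parameter, so continuity can be proved without restriction to [0,1]. *)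
Definition profile_path (s0 s1 s : R) : R3 R -> R :=
  profile (s0 + (s1 - s0) * `|s|).

Lemma continuous_powR_gt0 (r x : R) : 0 < x -> {for x, continuous (fun y : R => y `^ r)}.
Proof.
move=> x0; apply: differentiable_continuous; apply/derivable1_diffP.
by apply: derivable_powR; rewrite in_itv/= x0.
Qed.

Lemma profile_path_sphere s0 s1 : 0 < s0 -> s0 <= s1 ->
  sphere_path p c (profile_path s0 s1).
Proof.
move=> s00 s01.
have s10 : 0 <= s1 - s0 by rewrite subr_ge0.
have T0 (s : R) : s0 <= s0 + (s1 - s0) * `|s| by rewrite lerDl mulr_ge0.
have Tpos (s : R) : 0 < s0 + (s1 - s0) * `|s| by exact: lt_le_trans s00 (T0 s).
split=> [s _|t _]; first exact: profile_mass_sphere.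
apply: cvg_within_filter.
apply/(@cvg_nbhsP _ R^o) => u ut.
pose k (s : R) := (s0 + (s1 - s0) * `|s|) `^ p^-1 / c.
pose A (s : R) := c * k s `^ (3 / p) / m.
have kp s : 0 < k s by exact: profile_scale_gt0.
have kle s : s0 `^ p^-1 / c <= k s.
  rewrite /k ler_pM2r ?invr_gt0//; apply: ge0_ler_powR => //.
  - by rewrite invr_ge0 ltW.
  - by rewrite nnegrE ltW.
  - by rewrite nnegrE ltW.
have cT : s0 + (s1 - s0) * `|u n| @[n --> \oo] --> s0 + (s1 - s0) * `|t|.
  by apply: cvgD; [exact: cvg_cst|apply: cvgMl_tmp; exact: cvg_norm].
have ck : k (u n) @[n --> \oo] --> k t.
  apply: cvgMr_tmp.
  exact: (continuous_cvg _ (@continuous_powR_gt0 p^-1 _ (Tpos t)) cT).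
have cA : A (u n) @[n --> \oo] --> A t.
  apply: cvgMr_tmp; apply: cvgMl_tmp.
  exact: (continuous_cvg _ (@continuous_powR_gt0 (3 / p) _ (kp t)) ck).
apply: (cvg_W1p_dilation p1 (kappa := s0 `^ p^-1 / c) WQ _ _ _ _ _ cA ck).
- by move=> n; exact: profile_amplitude_gt0.
- exact: profile_amplitude_gt0.
- exact: profile_scale_gt0.
- by move=> n; exact: kle.
- exact: kle.
Qed.

Variable t1 : R.
Hypothesis t01 : t0 < t1.
Hypothesis ft1 : f t1 < 0.

Lemma profile_path_mp K s0 : 0 < s0 -> s0 <= t0 -> s0 <= K ->
  mp_paths a b p q c K (profile_path s0 t1).
Proof.
move=> s00 s0t0 s0K; have s0t1 : s0 <= t1 by rewrite (le_trans s0t0)// ltW.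
have E0 : profile_path s0 t1 0 = profile s0 by rewrite /profile_path normr0 mulr0 addr0.
have E1 : profile_path s0 t1 1 = profile t1 by rewrite /profile_path normr1 mulr1 addrC subrK.
split; first exact: profile_path_sphere.
  by rewrite E0; split; [exact: profile_mass_sphere|rewrite kin_profile].
by rewrite E1 energy_profile//; exact: lt_trans t01.
Qed.

Lemma mp_level_le K s0 : 0 < s0 -> s0 <= t0 -> s0 <= K ->
  (mp_level a b p q c K <= (f t0)%:E)%E.
Proof.
move=> s00 s0t0 s0K; have s0t1 : s0 <= t1 by rewrite (le_trans s0t0)// ltW.
apply: ge_ereal_inf; exists (ereal_sup [set (energy a b p q (profile_path s0 t1 t))%:E | t in `[0, 1]]).
  by exists (profile_path s0 t1) => //; exact: profile_path_mp.
apply: ge_ereal_sup => _ [s _ <-]; rewrite lee_fin.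
have Tpos : 0 < s0 + (t1 - s0) * `|s|.
  by apply: (lt_le_trans s00); rewrite lerDl mulr_ge0// subr_ge0.
by rewrite energy_profile//; exact: fiber_le_max.
Qed.

(* If t0 <= K, the path starting at [profile t0] does not rise above its own starting energy. *)
Lemma mp_geometry_lt K : mp_geometry a b p q c K -> K < t0.
Proof.
move=> [K0 geo]; rewrite ltNge; apply/negP => t0K.
have := geo _ (profile_path_mp t00 (lexx t0) t0K).
rewrite ltNge => /negP; apply; apply: le_trans (mp_level_le t00 (lexx t0) t0K) _.
by rewrite lee_fin le_max {1}/profile_path normr0 mulr0 addr0 energy_profile// lexx.
Qed.

Lemma mp_levelE K : mp_geometry a b p q c K -> mp_level a b p q c K = (f t0)%:E.
Proof.
move=> geo; have Kt0 := mp_geometry_lt geo; have [K0 _] := geo.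
(* As K < t0, the profile of kinetic energy exactly K is an admissible start for the upper bound. *)
apply/eqP; rewrite eq_le (mp_level_le K0 (ltW Kt0) (lexx K))/=.
by apply: mp_level_ge; exact: ltW.
Qed.

(** f(t0) > 0, since it strictly exceeds f(t0/2) >= 0; this leaves room above the negative end
    energy and, for small K, above the start energy. *)
Lemma mp_geometry_ex : exists K, mp_geometry a b p q c K.
Proof.
have h0 : 0 < t0 / 2 by rewrite divr_gt0.
have h1 : t0 / 2 < t0 by rewrite ltr_pdivrMr// ltr_pMr// ltr1n.
have f0 : 0 < f t0.
  apply: le_lt_trans (t0_max h0 (negbT (lt_eqF h1))).
  by apply: t0_ge0; rewrite !ltW.
have al0 : 0 < a / p by rewrite divr_gt0.
have be0 : 0 < b / (2 * p) by rewrite divr_gt0// mulr_gt0.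
have [K [K0 Kt0 Kf]] := small_quadratic al0 be0 t00 f0.
exists K; split=> // h hK.
have [_ [_ h0K] h1lt] := hK.
apply: lt_le_trans (mp_level_ge Kt0).
rewrite lte_fin gt_max (lt_trans h1lt)// andbT.
apply: le_lt_trans (energy_le_kin _) _; apply: le_lt_trans Kf.
by rewrite lerD// ler_pM2l// ler_pXn2r// nnegrE ?powR_ge0// ltW.
Qed.

End mountain_pass.

Unset Implicit Arguments.
Set Strict Implicit.

Theorem theorem1p8 (R : realType) (a b c p q : R) (Q : R3 R -> R)
  (ha : 0 < a) (hb : 0 < b) (hp : 3 / 2 < p <= 2) (hc : 0 < c)
  (hq : q < 3 * p / (3 - p))
  (hQ : ground_state p q Q)
  (hQ_grad : norm_L p (grad_abs Q) `^ p = norm_L p Q `^ p)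
  (hQ_mass : norm_L p Q `^ p = p / q * norm_L q Q `^ q)
  (hGN : forall u : R3 R -> R, W1p p u ->
    ('N[leb3]_q%:E[EFin \o u] <=
      ((q / p * (norm_L p Q `^ (q - p))^-1) `^ q^-1
       * norm_L p (grad_abs u) `^ (3 * (q - p) / (q * p))
       * norm_L p u `^ (1 - 3 * (q - p) / (q * p)))%:E)%E)
  (hcase : p + 2 * p ^+ 2 / 3 < q \/
    (q = p + 2 * p ^+ 2 / 3 /\
     (b * norm_L p Q `^ (2 * p ^+ 2 / 3) / 2) `^ (3 / (2 * p ^+ 2 - 3 * p))
       < c)) :
  exists t : R,
    unique_max_point (fiber_map a b p q c (norm_L p Q)) t /\
    let u := scaled_profile p c (norm_L p Q) (t `^ p^-1 / c) Q in
    [/\ mass_sphere p c u,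
        exists K : R, mp_geometry a b p q c K,
        forall K : R, mp_geometry a b p q c K ->
          mp_level a b p q c K = (fiber_map a b p q c (norm_L p Q) t)%:E /\
          (energy a b p q u)%:E = mp_level a b p q c K &
        exists lam : R, kirchhoff_solution a b p q c lam u].
Proof.
case/andP: hp => p32 p2.
have p0 : 0 < p by lra.
have p1 : 1 <= p by lra.
have p20 : 0 < 2 * p ^+ 2 / 3 by rewrite divr_gt0// mulr_gt0// exprn_gt0.
have pq : p < q.
  by case: hcase => [|[-> _]]; [apply: lt_trans; rewrite ltrDl|rewrite ltrDl].
have q0 : 0 < q by exact: lt_trans pq.
have [Qsol Q0 _] := hQ; have WQ : W1p p Q by case: Qsol.
have m0 := ground_norm_gt0 p1 WQ Q0.
have al0 : 0 < a / p by rewrite divr_gt0.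
have be0 : 0 < b / (2 * p) by rewrite divr_gt0// mulr_gt0.
have C0 : 0 < fiber_coef p q c (norm_L p Q).
  by rewrite /fiber_coef divr_gt0// ?mulr_gt0// powR_gt0.
have [t [t0 crit tmax tge0 [t1 tt1 ft1]]] :=
  fiber_shape al0 be0 C0 (fiber_case p32 hb hc m0 hcase).
exists t; split; first by split.
have level := mp_levelE hc p1 pq WQ Q0 hQ_grad hQ_mass hGN t0 tmax tge0 tt1 ft1.
split.
- exact: profile_mass_sphere.
- exact: (mp_geometry_ex ha hb hc p1 pq WQ Q0 hGN t0 tmax tge0).
- move=> K geo; rewrite (level K geo); split=> //.
  by rewrite energy_profile.
- exact: (profile_kirchhoff hc p1 WQ Q0 hQ_grad t0 crit Qsol).
Qed.
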